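(* Let $\beta>0$, $q>1$, $t>\beta+1$, $\sigma>1$, and let $\mu$ be a positive Borel measure on $\mathbb{D}$; fix $\tau>0$. Then there is a constant $C>0$ such that for every analytic function $f$ on $\mathbb{D}$ $$\Big\| \xi\mapsto\int_{\Gamma_\sigma(\xi)} \frac{(1-|z|)^t|f(z)|}{1-|z|}\, d\mu(z)\Big\|_{L^{q,\infty}(\mathbb{T})} \le C\sup_{z\in\mathbb{D}} |f(z)|(1-|z|)^\beta$$ if and only if $$\Big\| \xi\mapsto\int_{\Gamma_\sigma(\xi)} (1-|z|)^{t-1}\,\mu(D(z,\tau))\,\frac{(1-|z|)^{-\beta}}{(1-|z|)^2}\, dm_2(z)\Big\|_{L^{q,\infty}(\mathbb{T})} <\infty .$$
   Context: $\mathbb{D}$ is the unit disk, $\mathbb{T}$ the unit circle, $dm_2$ normalized area measure on $\mathbb{D}$, $dm$ Lebesgue arc-length measure on $\mathbb{T}$. The Lusin cone is $\Gamma_\sigma(\xi)=\{z\in\mathbb{D}: |1-\bar\xi z|<\sigma(1-|z|)\}$ for $\xi\in\mathbb{T}$. $L^{q,\infty}(\mathbb{T})$ is the weak $L^q$ (Lorentz) space with quasinorm $\|g\|_{L^{q,\infty}}=\sup_{\lambda>0}\lambda\, m(\{\xi:|g(\xi)|>\lambda\})^{1/q}$. For $a\in\mathbb{D}$, $\varphi_a(z)=\frac{a-z}{1-\bar a z}$; the Bergman distance is $d(z,w)=\frac12\log\frac{1+|\varphi_w(z)|}{1-|\varphi_w(z)|}$, and $D(a,\tau)=\{w\in\mathbb{D}: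 d(w,a)<\tau\}$. *)

(* Defs.v *)
(* R : realType.  Complex numbers are mathcomp
   real_closed's  R[i]  (complex R); the plane carries the product
   sigma-algebra on R * R (Borel x Borel = Borel sets of R^2). *)
From HB Require Import structures.
From mathcomp Require Import all_boot all_order all_algebra.
From mathcomp Require Import all_classical all_reals all_analysis.
From mathcomp Require Import complex.

Set Implicit Arguments.
Unset Strict Implicit.
Unset Printing Implicit Defensive.
Import Order.TTheory GRing.Theory Num.Theory.
Import numFieldNormedType.Exports.
Local Open Scope classical_set_scope.
Local Open Scope ring_scope.

Section Defs.
Context {R : realType}.

Definition toC (p : R * R) : R[i] := Complex p.1 p.2.

Definition cabs (z : R[i]) : R := Num.sqrt (complex.Re z ^+ 2 + complex.Im z ^+ 2).

Definition cdisk : set R[i] := [set z | cabs z < 1].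
Definition pdisk : set (R * R) := [set p | cabs (toC p) < 1].

Definition circ (theta : R) : R[i] := Complex (cos theta) (sin theta).

Definition lusin_cone (sigma : R) (xi : R[i]) : set (R * R) :=
  [set p | cabs (toC p) < 1 /\
           cabs (1 - conjc xi * toC p) < sigma * (1 - cabs (toC p))].

Definition phi (a z : R[i]) : R[i] := (a - z) / (1 - conjc a * z).

Definition bergman_dist (z w : R[i]) : R :=
  2^-1 * ln ((1 + cabs (phi w z)) / (1 - cabs (phi w z))).

Definition bergman_disk (a : R[i]) (tau : R) : set (R * R) :=
  [set p | cabs (toC p) < 1 /\ bergman_dist (toC p) a < tau].

Definition analytic_on_disk (f : R[i] -> R[i]) : Prop :=
  forall z, cdisk z -> exists l : R[i], forall eps : R, 0 < eps ->
    exists2 delta : R, 0 < delta & forall w : R[i],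
      0 < cabs (w - z) < delta ->
      cabs ((f w - f z) / (w - z) - l) < eps.

(* normalized area measure dm_2 = dA / pi; integral over A of a
   nonnegative extended-real function *)
Definition area_integral (A : set (R * R)) (g : R * R -> \bar R) : \bar R :=
  ((pi^-1)%:E * \int[(@lebesgue_measure R \x @lebesgue_measure R)%E]_(p in A) g p)%E.

Definition arc_measure (P : set R[i]) : \bar R :=
  lebesgue_measure [set theta : R | 0 <= theta < 2 * pi /\ P (circ theta)].

Definition weakLq_norm (q : R) (g : R[i] -> \bar R) : \bar R :=
  ereal_sup [set (lam%:E * (arc_measure [set xi | (lam%:E < `|g xi|)%E]) `^ q^-1)%E
            | lam in [set lam : R | 0 < lam]].

End Defs.

(* Main.v *)
(* Both conditions are compared with the weak L^q norm of one discrete sum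
   over a Whitney decomposition of the disk into pieces B_n, with points z_n in
   B_n at height about rho_n = 2^-k:
     G_s(xi) = sum_n rho_n^(t-1-beta) mu(B_n) [|xi - z_n| < s (1 - |z_n|)].
   The finiteness of the weak norm of G_s does not depend on the aperture
   s > 1, by the Hardy-Littlewood maximal inequality and the duality of
   L^(q,oo) with L^(q',1); this is where q > 1 enters.  On the area side,
   mu(D(w,tau)) is at least mu(B_n) for w in a grid square around B_n (small
   pieces) and at most the sum of the mu(B_n) over the pieces it meets, so the
   area integral lies between sums G_s and G_s'.  On the analytic side,
   |f(z)| <= M (1-|z|)^-beta gives the upper bound, and lacunary polynomials
   sum_(k = j mod J) 2^(beta k) z^(2^k - 1), whose moduli are comparable to
   (1-|z|)^-beta on the annuli of level j mod J, give the lower one.  All sums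
   are countable and nonnegative, so no sigma-finiteness of mu is needed. *)
Require Import Defs.
From HB Require Import structures.
From mathcomp Require Import all_boot all_order all_algebra.
From mathcomp Require Import all_classical all_reals all_analysis.
From mathcomp Require Import complex.
From mathcomp Require Import measurable_realfun.
From mathcomp Require Import ring lra.
Import Order.TTheory GRing.Theory Num.Theory.
Import numFieldNormedType.Exports.
Local Open Scope classical_set_scope.
Local Open Scope ring_scope.

Set Implicit Arguments.
Unset Strict Implicit.
Unset Printing Implicit Defensive.

(** Each comparison of an integral with [cone_sum] costs aperture: the integral over a cone lies
    below the sum of a wider aperture and above that of a narrower one. So the two bounds do not
    meet at one aperture, and the change of aperture is made once, on the discrete sum, whose
    superlevel sets are measurable and whose terms live on arcs of known size. The integrals enter
    only through pointwise bounds, and their superlevel sets only through monotonicity of the outer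
    measure. A lacunary test function is bounded below only on the levels of one residue class mod
    J, so J families of tests are used and the classes are added by a quasi-triangle inequality. The
    same classes keep grid squares of different levels apart on the area side. The tests are
    polynomials and see finitely many levels; their bounds are uniform in the truncation, and a
    monotone limit recovers the full sum. *)

Section ComplexModulus.
Context {R : realType}.
Implicit Types (z w : R[i]) (a b th : R).

Lemma cabs_normc z : cabs z = Normc.normc z.
Proof. by case: z. Qed.

Lemma cabs_ge0 z : 0 <= cabs z.
Proof. exact: sqrtr_ge0. Qed.

Lemma cabs0 : cabs (0 : R[i]) = 0.
Proof. by rewrite cabs_normc; exact: Normc.normc0. Qed.

Lemma cabs1 : cabs (1 : R[i]) = 1.
Proof. by rewrite cabs_normc; exact: Normc.normc1. Qed.

Lemma cabsM z w : cabs (z * w) = cabs z * cabs w.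
Proof. by rewrite !cabs_normc; exact: Normc.normcM. Qed.

Lemma cabsV z : cabs z^-1 = (cabs z)^-1.
Proof. by rewrite !cabs_normc; exact: Normc.normcV. Qed.

Lemma cabsX z n : cabs (z ^+ n) = cabs z ^+ n.
Proof.
by elim: n => [|n IH]; rewrite ?expr0 ?cabs1// !exprS cabsM IH.
Qed.

Lemma cabsN z : cabs (- z) = cabs z.
Proof. by rewrite !cabs_normc; exact: normcN. Qed.

Lemma cabs_conj z : cabs (conjc z) = cabs z.
Proof. by case: z => x y; rewrite /cabs /= sqrrN. Qed.

Lemma cabs_real a : 0 <= a -> cabs (Complex a 0) = a.
Proof. by move=> a0; rewrite /cabs/= expr0n/= addr0 sqrtr_sqr ger0_norm. Qed.

Lemma sqr_cabs z : cabs z ^+ 2 = complex.Re z ^+ 2 + complex.Im z ^+ 2.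
Proof. by rewrite sqr_sqrtr// addr_ge0 ?sqr_ge0. Qed.

Lemma cabsD z w : cabs (z + w) <= cabs z + cabs w.
Proof. by rewrite !cabs_normc; exact: le_normcD. Qed.

Lemma cabs_distC z w : cabs (z - w) = cabs (w - z).
Proof. by rewrite -cabsN opprB. Qed.

Lemma cabs_dist_triangle u z w : cabs (z - w) <= cabs (z - u) + cabs (u - w).
Proof.
by apply: le_trans (cabsD _ _); rewrite addrA subrK.
Qed.

Lemma cabs_le_dist z w : cabs z <= cabs w + cabs (z - w).
Proof. by apply: le_trans (cabsD _ _); rewrite addrC subrK. Qed.

Lemma cabs_ge_dist z w : cabs z - cabs w <= cabs (z + w).
Proof.
have := cabs_le_dist z (- w); rewrite cabsN opprK.
by move=> h; lra.
Qed.

Lemma ler_cabs_ReIm z : cabs z <= `|complex.Re z| + `|complex.Im z|.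
Proof.
rewrite -ler_sqr ?nnegrE ?cabs_ge0 ?addr_ge0//.
rewrite sqr_cabs sqrrD -(real_normK (num_real (complex.Re z))).
rewrite -(real_normK (num_real (complex.Im z))).
by rewrite lerD2r lerDl mulrn_wge0// mulr_ge0.
Qed.

Lemma Re_le_cabs z : `|complex.Re z| <= cabs z.
Proof.
rewrite -ler_sqr ?nnegrE ?cabs_ge0// sqr_cabs real_normK ?num_real//.
by rewrite lerDl sqr_ge0.
Qed.

Lemma Im_le_cabs z : `|complex.Im z| <= cabs z.
Proof.
rewrite -ler_sqr ?nnegrE ?cabs_ge0// sqr_cabs real_normK ?num_real//.
by rewrite lerDr sqr_ge0.
Qed.

Lemma cabs_circ th : cabs (circ th) = 1.
Proof. by rewrite /cabs/= cos2Dsin2 sqrtr1. Qed.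

(** Multiplication by the unimodular [circ th] turns the cone condition into a Euclidean distance to
    a boundary point, the form used from here on. *)
Lemma cone_dist th z : cabs (1 - conjc (circ th) * z) = cabs (circ th - z).
Proof.
rewrite -[LHS]mul1r -(cabs_circ th) -cabsM mulrBr mulr1; congr (cabs (_ - _)).
rewrite mulrA -[RHS]mul1r; congr (_ * _).
apply/eqP; rewrite eq_complex /=; apply/andP; split; apply/eqP.
- by rewrite mulrN opprK -!expr2 cos2Dsin2.
- by ring.
Qed.

End ComplexModulus.

(** * Chords and angles on the unit circle; polar form *)

Section CircleDistance.
Context {R : realType}.
Implicit Types (z : R[i]) (a b x th : R).

Lemma sin_MVT x : 0 < x -> exists2 c, 0 < c < x & sin x = cos c * x.
Proof.
move=> x0.
have [|c cx] := MVT (f := sin) (df := cos) x0 (fun y _ => is_derive_sin y).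
  by apply: continuous_subspaceT => y; exact: continuous_sin.
by rewrite sin0 !subr0 => sx; exists c => //; rewrite in_itv in cx.
Qed.

Lemma sin_le_id x : 0 <= x -> `|sin x| <= x.
Proof.
rewrite le_eqVlt => /predU1P[<-|x0]; first by rewrite sin0 normr0.
have [c _ ->] := sin_MVT x0.
by rewrite normrM (gtr0_norm x0) ler_piMl ?(ltW x0)// cos_max.
Qed.

(** A weak Jordan inequality: sin x = 2 cos(x/2) sin(x/2), the mean value theorem gives sin(x/2) >=
    cos(x/2) x/2, and 2 cos(x/2)^2 = 1 + cos x >= 1. *)
Lemma sin_ge_half x : 0 <= x <= pi / 2 -> x / 2 <= sin x.
Proof.
move=> /andP[]; rewrite le_eqVlt => /predU1P[<-|x0 xpi].
  by rewrite sin0 mul0r.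
have hx : 0 < x / 2 by lra.
have p0 : 0 < pi :> R := pi_gt0 R.
have [c /andP[c0 cx] sx] := sin_MVT hx.
have cx0 : 0 <= cos x by apply: cos_ge0_pihalf; apply/andP; split; lra.
have ch0 : 0 <= cos (x / 2) by apply: cos_ge0_pihalf; apply/andP; split; lra.
have cle : cos (x / 2) < cos c.
  by rewrite ltr_cos ?in_itv/=; [lra|apply/andP; split; lra|apply/andP; split; lra].
have xE : x = x / 2 + x / 2 by field.
have cosx : cos x = cos (x / 2) ^+ 2 *+ 2 - 1.
  rewrite {1}xE cosD -!expr2 sin2cos2; ring.
have -> : sin x = 2 * (cos (x / 2) * sin (x / 2)) by rewrite {1}xE sinD; ring.
rewrite sx.
have : cos (x / 2) * cos (x / 2) <= cos (x / 2) * cos c by rewrite ler_wpM2l // ltW.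
have h : 1 <= (cos (x / 2) * cos (x / 2)) * 2 by move: cx0; rewrite cosx mulr2n expr2; lra.
by nra.
Qed.

Lemma circ_dist a b : cabs (circ a - circ b) = 2 * `|sin ((a - b) / 2)|.
Proof.
apply/eqP; rewrite -(@eqrXn2 _ 2)// ?cabs_ge0 ?mulr_ge0//.
rewrite sqr_cabs exprMn real_normK ?num_real//=.
have -> : (cos a - cos b) ^+ 2 + (sin a - sin b) ^+ 2 = 2 - 2 * cos (a - b).
  by rewrite cosB; move: (cos2Dsin2 a) (cos2Dsin2 b); nra.
have E : a - b = (a - b) / 2 + (a - b) / 2 by field.
by rewrite {1}E cosD -!expr2 cos2sin2; apply/eqP; ring.
Qed.

Lemma circ_dist_le a b : cabs (circ a - circ b) <= `|a - b|.
Proof.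
rewrite circ_dist.
have -> : `|sin ((a - b) / 2)| = `|sin (`|a - b| / 2)|.
  by case: (ger0P (a - b)) => // _; rewrite mulNr sinN normrN.
have /sin_le_id : 0 <= `|a - b| / 2 by rewrite divr_ge0.
lra.
Qed.

Lemma circ_dist_ge a b : `|a - b| <= pi -> `|a - b| <= 2 * cabs (circ a - circ b).
Proof.
move=> ab; rewrite circ_dist.
have -> : `|sin ((a - b) / 2)| = `|sin (`|a - b| / 2)|.
  by case: (ger0P (a - b)) => // _; rewrite mulNr sinN normrN.
have h0 := normr_ge0 (a - b).
have /sin_ge_half : 0 <= `|a - b| / 2 <= pi / 2 by apply/andP; split; lra.
have : sin (`|a - b| / 2) <= `|sin (`|a - b| / 2)| by exact: ler_norm.
lra.
Qed.

Lemma circD2pi a : circ (a + 2 * pi) = circ a.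
Proof.
have -> : 2 * pi = pi *+ 2 :> R by rewrite mulr_natl.
by rewrite /circ cosD2pi sinD2pi.
Qed.

Lemma polar z : exists2 th, 0 <= th < 2 * pi &
  z = Complex (cabs z) 0 * circ th.
Proof.
have p0 : 0 < pi :> R := pi_gt0 R.
have [z0|zN0] := eqVneq (cabs z) 0.
  exists 0; first by apply/andP; split; lra.
  rewrite z0 (_ : Complex 0 0 = 0)// mul0r.
  by apply: Normc.eq0_normc; rewrite -cabs_normc.
have zp : 0 < cabs z by rewrite lt_neqAle eq_sym zN0 cabs_ge0.
set x := complex.Re z / cabs z; set y := complex.Im z / cabs z.
have xy : x ^+ 2 + y ^+ 2 = 1.
  by rewrite !expr_div_n -mulrDl -sqr_cabs divff// expf_neq0.
have x1 : -1 <= x <= 1.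
  by rewrite -ler_norml -(@ler_sqr _ `|x|) ?nnegrE// real_normK ?num_real// expr1n; nra.
have [/andP[a0 api] ca] := acos_def x1.
have sa : sin (acos x) = `|y|.
  rewrite sin_acos// -sqrtr_sqr; congr Num.sqrt; lra.
have zE : z = Complex (cabs z) 0 * Complex x y.
  rewrite [LHS](_ : _ = Complex (complex.Re z) (complex.Im z)); last by case: (z).
  apply/eqP; rewrite eq_complex/=; apply/andP; split; apply/eqP.
  - by rewrite mul0r subr0 /x mulrC divfK.
  - by rewrite mul0r addr0 /y mulrC divfK.
have [y0|y0] := leP 0 y.
  exists (acos x); first by apply/andP; split; lra.
  by rewrite /circ ca sa ger0_norm.
(* Lower half plane: this angle is below 2 pi because acos x cannot be 0, its sine being |y| > 0. *)
exists (- acos x + 2 * pi).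
  have : acos x != 0.
    by apply/eqP => h; move: sa; rewrite h sin0 => /esym/normr0P/eqP; lra.
  rewrite neq_lt => /orP[|]; lra.
by rewrite circD2pi /circ cosN sinN ca sa ltr0_norm// opprK.
Qed.

End CircleDistance.

(** * Integrals bounded through countable families of sets *)

Section IntegralMonotone.
Context d (T : measurableType d) (R : realType).
Variable mu : {measure set T -> \bar R}.
Local Open Scope ereal_scope.

(* The integral of a nonnegative function is a supremum over simple minorants,
   so no measurability is needed here. *)
Lemma ge0_le_integralT (f g : T -> \bar R) :
  (forall x, 0 <= f x) -> (forall x, f x <= g x) ->
  \int[mu]_x f x <= \int[mu]_x g x.
Proof.
move=> f0 fg; have g0 x : 0 <= g x by exact: le_trans (f0 x) (fg x).
rewrite !ge0_integralTE//; apply: ereal_sup_le => _ [h hf <-].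
by exists h => // x; exact: le_trans (hf x) (fg x).
Qed.

(** The majorant is integrated term by term; [g] itself enters only by monotonicity. *)
Lemma integral_cover_le (D : set T) (g : T -> \bar R) (c : nat -> \bar R)
    (U : nat -> set T) :
  (forall n, 0 <= c n) -> (forall n, measurable (U n)) ->
  (forall x, D x -> 0 <= g x) ->
  (forall x, D x -> g x <= \sum_(0 <= n <oo) c n * (\1_(U n) x)%:E) ->
  \int[mu]_(x in D) g x <= \sum_(0 <= n <oo) c n * mu (U n).
Proof.
move=> c0 mU g0 gU.
have mI n : measurable_fun setT (fun x => (\1_(U n) x)%:E : \bar R).
  by apply/measurable_EFinP; exact: measurable_indic.
rewrite integral_mkcond.
apply: (@le_trans _ _ (\int[mu]_x \sum_(0 <= n <oo) c n * (\1_(U n) x)%:E)).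
  apply: ge0_le_integralT => x; first exact: erestrict_ge0.
  rewrite patchE; case: ifPn => [/[!inE]/gU //|_].
  by apply: nneseries_ge0 => n _ _; rewrite mule_ge0// lee_fin.
rewrite integral_nneseries//.
- apply: lee_nneseries => n.
    by move=> _ _; apply: integral_ge0 => x _; rewrite mule_ge0// lee_fin.
  move=> _; rewrite (ge0_integralZl mu measurableT (mI n))//.
  by rewrite integral_indic// setIT.
- by move=> n; apply: measurable_funeM.
- by move=> n x _; rewrite mule_ge0// lee_fin.
Qed.

(** Inclusion in [D] is asked only where [c n] is nonzero, so that the coefficients can select the
    sets lying in a given cone. *)
Lemma integral_pack_ge (D : set T) (g : T -> \bar R) (c : nat -> \bar R)
    (U : nat -> set T) :
  (forall n, 0 <= c n) -> (forall n, measurable (U n)) ->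
  (forall x, D x -> 0 <= g x) -> (forall n, c n != 0 -> U n `<=` D) ->
  (forall x, D x -> \sum_(0 <= n <oo) c n * (\1_(U n) x)%:E <= g x) ->
  \sum_(0 <= n <oo) c n * mu (U n) <= \int[mu]_(x in D) g x.
Proof.
move=> c0 mU g0 UD gU.
have mI n : measurable_fun setT (fun x => (\1_(U n) x)%:E : \bar R).
  by apply/measurable_EFinP; exact: measurable_indic.
rewrite [leRHS]integral_mkcond.
apply: (@le_trans _ _ (\int[mu]_x \sum_(0 <= n <oo) c n * (\1_(U n) x)%:E)); last first.
  apply: ge0_le_integralT => x.
    by apply: nneseries_ge0 => n _ _; rewrite mule_ge0// lee_fin.
  rewrite patchE; case: ifPn => [/[!inE]/gU //|/negP xD].
  rewrite eseries0// => n _ _.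
  have [->|/UD cU] := eqVneq (c n) 0; first by rewrite mul0e.
  rewrite indicE memNset ?mule0//.
  by move=> /cU Dx; apply: xD; rewrite inE.
rewrite integral_nneseries//.
- apply: lee_nneseries => n.
    by move=> _ _; rewrite mule_ge0.
  move=> _; rewrite (ge0_integralZl mu measurableT (mI n))//.
  by rewrite integral_indic// setIT.
- by move=> n; apply: measurable_funeM.
- by move=> n x _; rewrite mule_ge0// lee_fin.
Qed.

End IntegralMonotone.

(** * Shadows on the circle and their lengths *)

Section ShadowArcs.
Context {R : realType}.
Implicit Types (z : R[i]) (s th r c p : R).
Local Notation leb := (@lebesgue_measure R).

(** [lebesgue_measure] is an outer measure on arbitrary sets, so superlevel sets can be compared by
    inclusion alone. *)
Lemma le_lebesgue (A B : set R) : A `<=` B -> (leb A <= leb B)%E.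
Proof. by move=> AB; exact: le_mu_ext. Qed.

Lemma lebesgue_measure_shift c (A : set R) : measurable A ->
  leb [set x | A (x + c)] = leb A.
Proof.
move=> mA.
suff : forall X, ocitv X -> leb X =
    pushforward leb (fun x : measurableTypeR R => x + c : measurableTypeR R) X.
  move/lebesgue_measure_unique => /(_ (measurable_funD (@measurable_id _ _ setT)
    (@measurable_cst _ _ _ _ setT c))) /(_ A mA) ->.
  by [].
move=> _ [[a b]] _ <-.
rewrite /pushforward /=.
rewrite (_ : _ @^-1` _ = `]a - c, b - c]%classic); last first.
  by apply/seteqP; split => x /=; rewrite !in_itv/= ltrBlDr lerBrDr.
by rewrite !lebesgue_measure_itv/= !lte_fin ltrD2r; case: ifP => //= _; congr EFin; lra.
Qed.

(** The angles whose cone of aperture [s] contains a point [z] of the disk, rewritten by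
    [cone_dist]. *)
Definition shadow s z : set R :=
  [set th | 0 <= th < 2 * pi /\ cabs (circ th - z) < s * (1 - cabs z)].

Lemma measurable_cabs_circ z :
  measurable_fun setT (fun th : R => cabs (circ th - z)).
Proof.
case: z => x y.
have mc : measurable_fun setT (fun th : R => cos th - x).
  apply: measurable_funB => //.
  by apply: continuous_measurable_fun => t; exact: continuous_cos.
have ms : measurable_fun setT (fun th : R => sin th - y).
  apply: measurable_funB => //.
  by apply: continuous_measurable_fun => t; exact: continuous_sin.
apply: (measurableT_comp (f := @Num.sqrt R)).
  by apply: continuous_measurable_fun => t; exact: sqrt_continuous.
exact: (measurable_funD (measurable_funX 2 mc) (measurable_funX 2 ms)).
Qed.

Lemma measurable_shadow s z : measurable (shadow s z).
Proof.
rewrite (_ : shadow s z = `[0, 2 * pi[%classic `&`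
    [set th | cabs (circ th - z) < s * (1 - cabs z)]).
  apply: measurableI => //; rewrite -[X in measurable X]setTI.
  have := @measurable_fun_ltr _ _ R setT _ _ (measurable_cabs_circ z)
    (@measurable_cst _ _ _ _ setT (s * (1 - cabs z))) measurableT [set true].
  exact.
by apply/seteqP; split => x /=; rewrite in_itv.
Qed.

(** The radial projection of z is at distance 1 - |z| from z, so angles within (s - 1)(1 - |z|) of
    arg z are in the shadow. The cap at 1 keeps the arc used no longer than 1. *)
Lemma shadow_lower s z : 1 < s -> cabs z < 1 ->
  ((Num.min (s - 1) 1 * (1 - cabs z))%:E <= leb (shadow s z))%E.
Proof.
move=> s1 z1; set k := Num.min _ _.
have k0 : 0 < k by rewrite lt_min subr_gt0 s1 ltr01.
have ks : k <= s - 1 by rewrite ge_min lexx.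
have k1 : k <= 1 by rewrite ge_min lexx orbT.
have c0 := cabs_ge0 z.
have p2 : 2 <= pi :> R := pi_ge2 R.
have [t0 /andP[t00 t02] zE] := polar z.
set d := k * (1 - cabs z).
have d0 : 0 < d by rewrite mulr_gt0// subr_gt0.
have d1 : d <= 1 by rewrite /d; nra.
have near_sh th : 0 <= th < 2 * pi -> `|th - t0| < d -> shadow s z th.
  move=> h hd; split => //.
  apply: le_lt_trans (cabs_dist_triangle (circ t0) _ _) _.
  have -> : cabs (circ t0 - z) = 1 - cabs z.
    rewrite {1}zE -{1}[circ t0]mul1r -mulrBl cabsM cabs_circ mulr1.
    rewrite (_ : 1 - _ = Complex (1 - cabs z) 0).
      by rewrite cabs_real// subr_ge0 ltW.
    by apply/eqP; rewrite eq_complex /= subr0 !eqxx.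
  have : cabs (circ th - circ t0) < k * (1 - cabs z) := le_lt_trans (circ_dist_le _ _) hd.
  by nra.
(* Only the half-arc pointing towards the middle of [0, 2 pi) is used; it fits since d <= 1 and pi
   >= 2. *)
have [tp|tp] := leP t0 pi.
  apply: (@le_trans _ _ (leb `[t0, t0 + d[%classic)).
    by rewrite lebesgue_measure_itv/= lte_fin ltrDl d0 lee_fin; lra.
  apply: le_lebesgue => x /=; rewrite in_itv/= => /andP[h1 h2]; apply: near_sh.
    by apply/andP; split; lra.
  by rewrite ger0_norm; lra.
apply: (@le_trans _ _ (leb `]t0 - d, t0]%classic)).
  rewrite lebesgue_measure_itv/= lte_fin ifT; last lra.
  by rewrite lee_fin; lra.
apply: le_lebesgue => x /=; rewrite in_itv/= => /andP[h1 h2]; apply: near_sh.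
  by apply/andP; split; lra.
by rewrite ler0_norm; lra.
Qed.

(** Angles live in [0, 2 pi), so an arc around [th] may wrap around; the two translates by 2 pi
    catch the part that does. *)
Definition ball3 th r : set R :=
  [set x | [\/ `|x - th| < r, `|x - (th + 2 * pi)| < r | `|x - (th - 2 * pi)| < r]].

Lemma shadow_ball3 s s' z th : shadow s z th ->
  shadow s' z `<=` ball3 th (2 * (s + s') * (1 - cabs z)).
Proof.
move=> [/andP[t0 t2] ts] x [/andP[x0 x2] xs].
have := cabs_dist_triangle z (circ x) (circ th); rewrite (cabs_distC z (circ th)) => tri.
have {tri} D : 2 * cabs (circ x - circ th) < 2 * (s + s') * (1 - cabs z) by lra.
have p0 : 0 < pi :> R := pi_gt0 R.
have [h1|h1] := leP `|x - th| pi.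
  by constructor 1; apply: le_lt_trans D; exact: circ_dist_ge.
have [h2|h2] := leP th x.
- constructor 2; apply: le_lt_trans D.
  rewrite -(circD2pi th); apply: circ_dist_ge.
  by move: h1; rewrite ger0_norm ?subr_ge0// => h1; rewrite ler0_norm; lra.
- constructor 3; apply: le_lt_trans D.
  rewrite -{2}(subrK (2 * pi) th) circD2pi; apply: circ_dist_ge.
  by move: h1; rewrite ltr0_norm ?subr_lt0// => h1; rewrite ger0_norm; lra.
Qed.

Lemma ball3_measure th r : 0 <= r -> (leb (ball3 th r) <= (6 * r)%:E)%E.
Proof.
move=> r0.
rewrite (_ : ball3 th r = ball th r `|` (ball (th + 2 * pi) r `|` ball (th - 2 * pi) r)).
  have mb x := @measurable_ball R x r.
  apply: le_trans (measureU2 leb (mb _) (measurableU _ _ (mb _) (mb _))) _.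
  apply: le_trans (leeD2l _ (measureU2 leb (mb _) (mb _))) _.
  have mball x : (leb (ball x r) <= (r *+ 2)%:E)%E by rewrite lebesgue_measure_ball.
  apply: le_trans (leeD (mball _) (leeD (mball _) (mball _))) _.
  by rewrite -!EFinD lee_fin; lra.
apply/seteqP; split => x /=; rewrite /ball /= /ball_ /=.
- by case=> h; [left|right; left|right; right]; rewrite distrC.
- by case=> [h|[h|h]]; [constructor 1|constructor 2|constructor 3]; rewrite distrC.
Qed.

End ShadowArcs.

(** * Sums of nonnegative series *)

Section NonnegativeSeries.
Context {R : realType}.
Local Open Scope ereal_scope.

Lemma nneseries_le_ub (u : nat -> \bar R) (M : \bar R) :
  (forall n, 0 <= u n) -> (forall n, (\sum_(0 <= i < n) u i)%R <= M) ->
  \sum_(0 <= i <oo) u i <= M.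
Proof.
move=> u0 uM; apply: lime_le; first by apply: is_cvg_nneseries => n _ _.
exact: nearW.
Qed.

Lemma nneseries_ge_term (u : nat -> \bar R) k :
  (forall n, 0 <= u n) -> u k <= \sum_(0 <= i <oo) u i.
Proof.
move=> u0; apply: le_trans (nneseries_lim_ge k.+1 (fun n _ _ => u0 n)).
by rewrite big_nat_recr//= leeDr// sume_ge0.
Qed.

Lemma geometric_sum_le (c x : R) n : (0 <= c)%R -> (0 <= x < 1)%R ->
  (\sum_(i < n) c * x ^+ i <= c / (1 - x))%R.
Proof.
move=> c0 /andP[x0 x1]; have x1' : (1 - x != 0)%R by rewrite gt_eqF// subr_gt0.
have -> : (\sum_(i < n) c * x ^+ i = c / (1 - x) - c / (1 - x) * x ^+ n)%R.
  elim: n => [|n IH]; first by rewrite big_ord0 expr0 mulr1 subrr.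
  by rewrite big_ord_recr/= IH exprS; field.
by rewrite lerBlDr lerDl mulr_ge0 ?exprn_ge0// divr_ge0// subr_ge0 ltW.
Qed.

Lemma geometric_nneseries_le (c x : R) : (0 <= c)%R -> (0 <= x < 1)%R ->
  \sum_(0 <= i <oo) (c * x ^+ i)%:E <= (c / (1 - x))%:E.
Proof.
move=> c0 x01; have /andP[x0 _] := x01.
apply: nneseries_le_ub => [n|n]; first by rewrite lee_fin mulr_ge0// exprn_ge0.
by rewrite big_mkord sumEFin lee_fin geometric_sum_le.
Qed.

End NonnegativeSeries.

(** * Covering bound from the Hardy-Littlewood maximal inequality *)

Section MaximalFunction.
Context {R : realType}.
Local Notation leb := (@lebesgue_measure R).
Local Open Scope ereal_scope.

Lemma integral_abs_indic (F D : set R) : measurable F -> measurable D ->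
  \int[leb]_(x in D) `|(\1_F x)%:E| = leb (F `&` D).
Proof.
move=> mF mD; rewrite -(integral_indic leb mD mF); apply: eq_integral => x _.
by rewrite gee0_abs// lee_fin.
Qed.

Lemma HL_indic_gt (F : set R) (y r p : R) : measurable F -> (0 < r)%R ->
  (p * r)%:E < leb (F `&` ball y r) -> (p / 2)%:E < HL_maximal \1_F y.
Proof.
move=> mF r0 h.
apply: (@lt_le_trans _ _ (iavg \1_F (ball y r))); last first.
  by apply: ereal_sup_ubound; exists r => //=; rewrite in_itv/= r0.
rewrite /iavg integral_abs_indic//; last exact: measurable_ball.
rewrite [X in X^-1](lebesgue_measure_ball _ (ltW r0)) inver mulrn_eq0/= gt_eqF//.
rewrite -[X in X < _](_ : (((r *+ 2)^-1)%R%:E * (p * r)%:E) = _); last first.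
  by rewrite -EFinM; congr EFin; field; rewrite gt_eqF.
by rewrite lte_pmul2l// lte_fin invr_gt0 pmulrn_rgt0.
Qed.

(** One of the three balls of [ball3 th r] carries a third of the mass, so the maximal function of
    the indicator exceeds p/6 at [th] or at a translate by 2 pi. Each of these three sets has
    measure at most 3/(p/6) = 18/p times that of [F]. *)
Lemma maximal_cover (F E : set R) (p : R) : measurable F -> (0 < p)%R ->
  (forall th, E th -> exists2 r : R, (0 < r)%R & (p * r)%:E < leb (F `&` ball3 th r)) ->
  leb E <= (54 / p)%:E * leb F.
Proof.
move=> mF p0 HE.
have lF : locally_integrable setT (\1_F : R -> R).
  by apply: locally_integrable_indic => //; exact: openT.
pose H := [set x | (p / 6)%:E < HL_maximal \1_F x].
have mH : measurable H.
  by rewrite -[H]setTI; apply: emeasurable_fun_o_infty => //; exact: measurable_HL_maximal.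
have lebH : leb H <= (18 / p)%:E * leb F.
  apply: le_trans (maximal_inequality lF _) _; first by rewrite divr_gt0.
  rewrite integral_abs_indic// setIT.
  by rewrite (_ : 3 / (p / 6) = 18 / p)%R//; field; rewrite gt_eqF.
have mHs (c : R) : measurable [set x | H (x + c)%R].
  rewrite -[X in measurable X]setTI.
  by apply: (measurable_funD (@measurable_id _ _ setT) (@measurable_cst _ _ _ _ setT c)).
have EH : E `<=` H `|` ([set x | H (x + 2 * pi)%R] `|` [set x | H (x - 2 * pi)%R]).
  move=> th /HE[r r0 hr].
  have mB y : measurable (F `&` ball y r) by apply: measurableI => //; exact: measurable_ball.
  have B3 : F `&` ball3 th r `<=` (F `&` ball th r) `|`
      ((F `&` ball (th + 2 * pi)%R r) `|` (F `&` ball (th - 2 * pi)%R r)).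
    by move=> x [Fx]; case=> h; [left|right; left|right; right]; split => //;
      rewrite /ball/= /ball_/= distrC.
  have big : (p * r)%:E < leb (F `&` ball th r) + (leb (F `&` ball (th + 2 * pi)%R r)
      + leb (F `&` ball (th - 2 * pi)%R r)).
    apply: (lt_le_trans hr); apply: le_trans (le_lebesgue B3) _.
    apply: le_trans (measureU2 leb (mB _) (measurableU _ _ (mB _) (mB _))) _.
    exact: leeD2l _ (measureU2 leb (mB _) (mB _)).
  have p3 : (p / 6 = p / 3 / 2)%R by field.
  have key y : (p / 3 * r)%:E < leb (F `&` ball y r) -> H y.
    by rewrite /H /= p3; exact: HL_indic_gt.
  have [/key|h1] := ltP (p / 3 * r)%:E (leb (F `&` ball th r)); first by left.
  have [/key|h2] := ltP (p / 3 * r)%:E (leb (F `&` ball (th + 2 * pi)%R r)).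
    by right; left.
  have [/key|h3] := ltP (p / 3 * r)%:E (leb (F `&` ball (th - 2 * pi)%R r)).
    by right; right.
  have := lt_le_trans big (leeD h1 (leeD h2 h3)).
  by rewrite -!EFinD lte_fin => abs; exfalso; lra.
apply: le_trans (le_lebesgue EH) _.
apply: le_trans (measureU2 leb mH (measurableU _ _ (mHs _) (mHs _))) _.
apply: le_trans (leeD2l _ (measureU2 leb (mHs _) (mHs _))) _.
have sh c : leb [set x | H (x + c)%R] <= (18 / p)%:E * leb F.
  by have -> := lebesgue_measure_shift c mH.
apply: le_trans (leeD lebH (leeD (sh _) (sh _))) _.
have c0 : 0 <= (18 / p)%:E :> \bar R by rewrite lee_fin divr_ge0// ltW.
rewrite -!ge0_muleDl ?adde_ge0// -!EFinD.
by rewrite (_ : 18 / p + (18 / p + 18 / p) = 54 / p)%R//; field; rewrite gt_eqF.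
Qed.

End MaximalFunction.

(** * Integrals of weak L^q functions over small sets *)

Section WeakIntegral.
Context {R : realType}.
Local Notation leb := (@lebesgue_measure R).
Local Open Scope ereal_scope.

Lemma powR2N_lt1 (e : R) : (0 < e)%R -> (2 `^ (- e) < 1 :> R)%R.
Proof.
move=> e0; rewrite powRN invf_lt1 ?powR_gt0//.
have /= := gt0_ltr_powR e0 (x := 1%R) (y := 2%R); rewrite powR1; apply.
- by rewrite nnegrE.
- by rewrite nnegrE.
- by rewrite ltr1n.
Qed.

Lemma le_id_pow2 n : (n%:R <= 2 ^+ n :> R)%R.
Proof. by rewrite -natrX ler_nat ltnW// ltn_expl. Qed.

(* The indicator case of the duality between L^(q,oo) and L^(q',1); in the
   proof the dyadic levels of g start at N A^(-1/q). *)
Lemma weak_integral_le (q N A : R) (g : R -> \bar R) (E : set R) :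
  (1 < q)%R -> (0 < N)%R -> (0 < A)%R ->
  measurable_fun setT g -> (forall th, 0 <= g th) ->
  (forall lam : R, (0 < lam)%R ->
    leb [set th | (0 <= th < 2 * pi)%R /\ lam%:E < g th] <= ((N / lam) `^ q)%:E) ->
  measurable E -> leb E <= A%:E -> (forall th, E th -> (0 <= th < 2 * pi)%R) ->
  \int[leb]_(th in E) g th <= (2 / (1 - 2 `^ (1 - q)) * N * A `^ (1 - q^-1))%:E.
Proof.
move=> q1 N0 A0 mg g0 gw mE EA E2.
have q0 : (0 < q)%R by rewrite (lt_trans _ q1).
(* The level at which the weak bound (N / l0)^q equals A. *)
pose l0 := (N * A `^ (- q^-1))%R.
have l00 : (0 < l0)%R by rewrite mulr_gt0// powR_gt0.
pose U n := if n is 0%N then E else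
  [set th | (0 <= th < 2 * pi)%R /\ (2 ^+ n * l0)%:E < g th].
pose c n : \bar R := (2 ^+ n.+1 * l0)%:E.
have c0 n : 0 <= c n by rewrite lee_fin mulr_ge0// ltW.
have mU n : measurable (U n).
  case: n => [//|n].
  rewrite (_ : U _ = `[0%R, (2 * pi)%R[%classic `&` [set th | (2 ^+ n.+1 * l0)%:E < g th]).
    apply: measurableI => //; rewrite -[X in measurable X]setTI.
    exact: emeasurable_fun_o_infty.
  by apply/seteqP; split => x /=; rewrite in_itv.
have cover th : E th -> g th <= \sum_(0 <= n <oo) c n * (\1_(U n) th)%:E.
  move=> Eth.
  have S0 n : 0 <= c n * (\1_(U n) th)%:E by rewrite mule_ge0// lee_fin.
  have low (y : R) : y%:E <= g th -> y%:E <= \sum_(0 <= n <oo) c n * (\1_(U n) th)%:E.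
    move=> yg.
    (* One term of the series suffices: for the least such n, minimality puts [th] into [U n], while
       [U 0 = E] takes care of values up to 2 l0. *)
    have ex : exists n, (y <= 2 ^+ n.+1 * l0)%R.
      exists (Num.truncn (y / l0)).+1.
      have : (y / l0 < (Num.truncn (y / l0)).+1%:R)%R by exact: truncnS_gt.
      rewrite ltr_pdivrMr// => /ltW/le_trans; apply; rewrite ler_wpM2r ?(ltW l00)//.
      apply: le_trans (le_id_pow2 _) _.
      by rewrite ler_weXn2l// ler1n.
    case: (ex_minnP ex) => n yn min_n.
    apply: le_trans (nneseries_ge_term n S0).
    have -> : \1_(U n) th = 1%R :> R.
      rewrite indicE mem_set//; case: n yn min_n => [//|n] yn min_n.
      split; first exact: E2.
      apply: lt_le_trans yg; rewrite lte_fin ltNge; apply/negP => /min_n.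
      by rewrite ltnn.
    by rewrite mule1 lee_fin.
  case E1 : (g th) low (g0 th) => [y| |] low //.
  - by move=> _; exact: low.
  - move=> _; rewrite leye_eq; apply/eqP/eqyP => y _; apply: low; exact: leey.
apply: le_trans (integral_cover_le leb c0 mU (fun x _ => g0 x) cover) _.
have muU n : leb (U n) <= (A * (2 `^ (- q)) ^+ n)%:E.
  case: n => [|n]; first by rewrite expr0 mulr1.
  have l1 : (0 < 2 ^+ n.+1 * l0)%R by rewrite mulr_gt0// exprn_gt0.
  apply: le_trans (gw _ l1) _.
  rewrite lee_fin le_eqVlt; apply/orP; left; apply/eqP.
  rewrite /l0.
  have -> : (N / (2 ^+ n.+1 * (N * A `^ (- q^-1))) = A `^ q^-1 * (2 ^+ n.+1)^-1)%R.
    rewrite powRN; field; rewrite !gt_eqF//= ?exprn_gt0 ?powR_gt0//.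
  rewrite powRM ?powR_ge0 ?invr_ge0 ?exprn_ge0//.
  rewrite -powRrM mulVf ?gt_eqF// powRr1 ?ltW//; congr (_ * _)%R.
  rewrite -powR_mulrn ?powR_ge0// -powRrM -powR_mulrn// -powRN -powRrM.
  by congr (_ `^ _)%R; ring.
(* The term of index n is the height 2^(n+1) l0 times a measure at most A 2^(-qn), whence the ratio
   2^(1-q), below 1 because q > 1. *)
have x1 : (0 <= (2 : R) `^ (1 - q) < 1)%R.
  by rewrite powR_ge0/= -[(1 - q)%R]opprB powR2N_lt1// subr_gt0.
have -> : (2 / (1 - 2 `^ (1 - q)) * N * A `^ (1 - q^-1) =
    (2 * (N * A `^ (1 - q^-1))) / (1 - 2 `^ (1 - q)))%R by ring.
apply: le_trans (geometric_nneseries_le _ x1); last first.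
  by rewrite !mulr_ge0 ?powR_ge0// ltW.
apply: lee_nneseries => [n _ _|n _]; first by rewrite mule_ge0.
apply: le_trans (lee_wpmul2l (c0 n) (muU n)) _.
rewrite /c -EFinM lee_fin le_eqVlt; apply/orP; left; apply/eqP.
have AE : (A `^ (1 - q^-1) = A * A `^ (- q^-1))%R.
  by rewrite powRD ?(gt_eqF A0) ?implybT// powRr1 ?(ltW A0).
have twoE : ((2 : R) `^ (1 - q) = 2 * 2 `^ (- q))%R.
  by rewrite powRD ?pnatr_eq0 ?implybT// powRr1.
by rewrite /l0 exprS AE twoE exprMn; ring.
Qed.

End WeakIntegral.

(** * Discrete cone sums and weak tails *)

Section ApertureChange.
Context {R : realType}.
Local Notation leb := (@lebesgue_measure R).
Local Open Scope ereal_scope.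

(** The superlevel form of a weak quasinorm bound by [N], free of roots and absolute values; it is
    the form that passes to sums and limits. *)
Definition weak_tail (q N : R) (g : R[i] -> \bar R) : Prop :=
  forall lam : R, (0 < lam)%R ->
    arc_measure [set xi | lam%:E < g xi] <= ((N / lam) `^ q)%:E.

Definition cone_sum (s : R) (z : nat -> R[i]) (a : nat -> \bar R) (xi : R[i]) : \bar R :=
  \sum_(0 <= n <oo) if (cabs (xi - z n) < s * (1 - cabs (z n)))%R then a n else 0.

Variables (z : nat -> R[i]) (a : nat -> \bar R).
Hypothesis a0 : forall n, 0 <= a n.

(** [cone_sum] read in the angle as a series of indicators, to which measurability and term-by-term
    integration apply. *)
Definition shadow_sum (s : R) (th : R) : \bar R :=
  \sum_(0 <= n <oo) a n * (\1_(shadow s (z n)) th)%:E.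

Lemma cone_sum_shadow s th : (0 <= th < 2 * pi)%R ->
  cone_sum s z a (circ th) = shadow_sum s th.
Proof.
move=> h; rewrite /cone_sum /shadow_sum; apply: eq_eseriesr => n _.
rewrite indicE; case: ifPn => hc.
  by rewrite mem_set ?mule1.
by rewrite memNset ?mule0// => -[_]; exact/negP.
Qed.

Lemma measurable_shadow_sum s : measurable_fun setT (shadow_sum s).
Proof.
apply: ge0_emeasurable_sum => n *; first by rewrite mule_ge0// lee_fin.
apply: measurable_funeM; apply/measurable_EFinP; apply: measurable_indic.
exact: measurable_shadow.
Qed.

Lemma shadow_sum_ge0 s th : 0 <= shadow_sum s th.
Proof. by apply: nneseries_ge0 => n _ _; rewrite mule_ge0// lee_fin. Qed.

Lemma integral_shadow_sum s (D : set R) : measurable D ->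
  \int[leb]_(th in D) shadow_sum s th =
  \sum_(0 <= n <oo) a n * leb (shadow s (z n) `&` D).
Proof.
move=> mD.
have mI n : measurable_fun D (fun x => (\1_(shadow s (z n)) x)%:E : \bar R).
  apply/measurable_EFinP; apply: measurable_indic; exact: measurable_shadow.
rewrite integral_nneseries//.
- apply: eq_eseriesr => n _; rewrite (ge0_integralZl leb mD (mI n))//.
  by rewrite integral_indic//; exact: measurable_shadow.
- by move=> n; exact: measurable_funeM (mI n).
- by move=> n x _; rewrite mule_ge0// lee_fin.
Qed.

Lemma weak_tail_shadow q N s : weak_tail q N (cone_sum s z a) <->
  forall lam : R, (0 < lam)%R ->
    leb [set th | (0 <= th < 2 * pi)%R /\ lam%:E < shadow_sum s th]
      <= ((N / lam) `^ q)%:E.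
Proof.
suff E lam : arc_measure [set xi | lam%:E < cone_sum s z a xi] =
    leb [set th | (0 <= th < 2 * pi)%R /\ lam%:E < shadow_sum s th].
  by split => h lam lam0; have := h lam lam0; rewrite E.
rewrite /arc_measure; congr (leb _); apply/seteqP; split => th /= [h].
- by rewrite cone_sum_shadow.
- by rewrite cone_sum_shadow.
Qed.

End ApertureChange.

(** * Independence of the aperture *)

Section ApertureChangeTheorem.
Context {R : realType}.
Local Notation leb := (@lebesgue_measure R).
Local Open Scope ereal_scope.
Variables (z : nat -> R[i]) (a : nat -> \bar R).
Hypothesis z1 : forall n, (cabs (z n) < 1)%R.
Hypothesis a0 : forall n, 0 <= a n.

(* If F is the superlevel set of the wider sum, the shadows in which F has
   relative density about 2^-i lie in a set E_i of measure O(2^i |F|) (maximal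
   inequality), and the wider sum integrated over F is at most
   sum_i 2^-i int_(E_i) (narrow sum), a geometric series since q > 1. *)
Lemma aperture_change (q s s' N : R) : (1 < q)%R -> (1 < s)%R -> (1 < s')%R ->
  (0 < N)%R -> weak_tail q N (cone_sum s z a) ->
  exists2 N', (0 < N')%R & weak_tail q N' (cone_sum s' z a).
Proof.
move=> q1 s1 s'1 N0 /(weak_tail_shadow z a q N s) gw.
have q0 : (0 < q)%R by rewrite (lt_trans _ q1).
set kk := Num.min (s - 1)%R 1%R.
have kk0 : (0 < kk)%R by rewrite lt_min subr_gt0 s1 ltr01.
(* [ball3_measure] contributes 6 and the radius in [shadow_ball3] is 2 (s + s') (1 - |z|). *)
pose P0 := (12 * (s + s'))%R.
have P00 : (0 < P0)%R by rewrite /P0; lra.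
pose Kq := (2 / (1 - 2 `^ (1 - q)))%R : R.
have Kq0 : (0 < Kq)%R.
  by rewrite divr_gt0// subr_gt0 -[(1 - q)%R]opprB powR2N_lt1// subr_gt0.
have y1 : (0 <= (2 : R) `^ (- q^-1) < 1)%R.
  by rewrite powR_ge0/= powR2N_lt1// invr_gt0.
have y1' : (0 < 1 - (2 : R) `^ (- q^-1))%R by rewrite subr_gt0; case/andP: y1.
(* P0 / kk compares wide with narrow shadows, Kq and the power of 18 come from [weak_integral_le] on
   [E i], and the denominator sums over i. *)
pose C := (P0 / kk * Kq * 18 `^ (1 - q^-1) / (1 - 2 `^ (- q^-1)))%R.
have C0 : (0 < C)%R.
  by rewrite divr_gt0// mulr_gt0 ?powR_gt0// mulr_gt0// divr_gt0.
exists (C * N)%R; first exact: mulr_gt0.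
apply/(weak_tail_shadow z a) => lam lam0.
set F := [set th | _].
have mF : measurable F.
  rewrite (_ : F = `[0%R, (2 * pi)%R[%classic `&` [set th | lam%:E < shadow_sum z a s' th]).
    apply: measurableI => //; rewrite -[X in measurable X]setTI.
    by apply: emeasurable_fun_o_infty => //; exact: measurable_shadow_sum.
  by apply/seteqP; split => x /=; rewrite in_itv.
have lebF : leb F <= (2 * pi)%:E.
  apply: (@le_trans _ _ (leb `[0%R, (2 * pi)%R[%classic)).
    by apply: le_lebesgue => x /= [h _]; rewrite in_itv.
  rewrite lebesgue_measure_itv/=; case: ifPn => _; last by rewrite lee_fin mulr_ge0// pi_ge0.
  by rewrite sube0.
have Ffin (D : set R) : leb (F `&` D) \is a fin_num.
  rewrite ge0_fin_numE//; apply: (@le_lt_trans _ _ (2 * pi)%:E); last exact: ltry.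
  by apply: le_trans lebF; apply: le_lebesgue => x [].
have Ffin' : leb F \is a fin_num by have := Ffin setT; rewrite setIT.
set x := fine (leb F).
have xE : leb F = x%:E by rewrite /x fineK.
(* With 0 < x < oo, division by x^(1 - 1/q) is possible at the end. *)
have [x0|xN0] := eqVneq x 0%R; first by rewrite xE x0 lee_fin powR_ge0.
have x0 : (0 < x)%R by rewrite lt_neqAle eq_sym xN0/= fine_ge0.
pose m n := fine (leb (F `&` shadow s' (z n))).
have mE n : leb (F `&` shadow s' (z n)) = (m n)%:E by rewrite /m fineK.
pose de n := (1 - cabs (z n))%R.
have de0 n : (0 < de n)%R by rewrite subr_gt0.
have shad n : (kk * de n)%:E <= leb (shadow s (z n)) by exact: shadow_lower.
have mP n : (m n <= P0 * de n)%R.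
  have [th sth] : shadow s (z n) !=set0.
    apply/set0P/eqP => sh0; have := shad n; rewrite sh0 measure0 lee_fin.
    by rewrite leNgt mulr_gt0.
  rewrite -lee_fin -mE.
  apply: (@le_trans _ _ (leb (ball3 th (2 * (s + s') * de n)))).
    by apply: le_lebesgue => y [_]; exact: shadow_ball3.
  apply: le_trans (ball3_measure _ _) _.
    by rewrite !mulr_ge0// ?(ltW (de0 n))//; lra.
  by rewrite lee_fin /P0; lra.
pose E i := \bigcup_(n in [set n | (P0 / 2 ^+ i.+1 * de n < m n)%R]) shadow s (z n).
have mEE i : measurable (E i).
  by apply: bigcup_measurable => n _; exact: measurable_shadow.
have E2 i th : E i th -> (0 <= th < 2 * pi)%R by move=> [n _ []].
(* [maximal_cover] with density p = 6 / 2^(i+1) relative to the radius of [ball3] gives the factor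
   54 / p = 18 * 2^i. *)
pose A i := (18 * 2 ^+ i * x)%R.
have A0 i : (0 < A i)%R by rewrite !mulr_gt0// exprn_gt0.
have EA i : leb (E i) <= (A i)%:E.
  have p0 : (0 < 6 / 2 ^+ i.+1 :> R)%R by rewrite divr_gt0// exprn_gt0.
  apply: le_trans (maximal_cover mF p0 _) _.
    move=> th [n /= hn sth]; exists (2 * (s + s') * de n)%R.
      by rewrite !mulr_gt0//; lra.
    apply: (@lt_le_trans _ _ (m n)%:E).
      rewrite lte_fin (le_lt_trans _ hn)// le_eqVlt; apply/orP; left; apply/eqP.
      by rewrite /P0; ring.
    rewrite -mE; apply: le_lebesgue => y [Fy sy]; split => //.
    exact: shadow_ball3 sth _ sy.
  rewrite xE -EFinM lee_fin /A exprS le_eqVlt; apply/orP; left; apply/eqP.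
  by field; rewrite expf_neq0.
pose c i := (P0 / kk / 2 ^+ i)%R.
have c0 i : (0 <= c i)%R by rewrite !divr_ge0 ?exprn_ge0 ?ltW.
(* Each point is charged to the least i with [m n] above P0 2^(-i-1) (1 - |z_n|): its narrow shadow
   then lies in [E i], and by minimality [m n] is at most twice that threshold. *)
have key n : exists i, leb (F `&` shadow s' (z n)) <= (c i)%:E * leb (shadow s (z n) `&` E i).
  have [m0|mpos] := leP (m n) 0%R.
    by exists 0%N; rewrite mE; apply: (@le_trans _ _ 0); rewrite ?lee_fin// mule_ge0 ?lee_fin.
  have ex : exists i, (P0 / 2 ^+ i.+1 * de n < m n)%R.
    exists (Num.truncn (P0 * de n / m n)).+1.
    rewrite mulrAC ltr_pdivrMr ?exprn_gt0// [X in (_ < X)%R]mulrC -ltr_pdivrMr//.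
    apply: lt_le_trans (truncnS_gt _) _.
    by apply: le_trans (le_id_pow2 _) _; rewrite ler_weXn2l// ler1n.
  case: (ex_minnP ex) => i hi min_i; exists i.
  rewrite (_ : shadow s (z n) `&` E i = shadow s (z n)); last first.
    by apply/setIidPl => th sth; exists n.
  have mle : (m n <= P0 / 2 ^+ i * de n)%R.
    case: i hi min_i => [|i] hi min_i; first by rewrite expr0 divr1.
    by rewrite leNgt; apply/negP => /min_i; rewrite ltnn.
  rewrite mE; apply: le_trans (lee_wpmul2l _ (shad n)); last by rewrite lee_fin.
  rewrite -EFinM lee_fin (le_trans mle)// le_eqVlt; apply/orP; left; apply/eqP.
  by rewrite /c; field; rewrite expf_neq0//= gt_eqF.
(* The wide sum exceeds [lam] on [F]; its integral over [F] is redistributed to integrals of the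
   narrow sum over the [E i]. *)
have main : (lam * x)%:E <= (C * N * x `^ (1 - q^-1))%:E.
  apply: (@le_trans _ _ (\int[leb]_(th in F) shadow_sum z a s' th)).
    rewrite EFinM -xE -integral_cst// [leLHS]integral_mkcond [leRHS]integral_mkcond.
    apply: ge0_le_integralT => th.
      by apply: erestrict_ge0 => y _; rewrite lee_fin ltW.
    by apply: lee_restrict => y [_ /ltW].
  rewrite integral_shadow_sum//.
  apply: (@le_trans _ _ (\sum_(0 <= n <oo) \sum_(0 <= i <oo)
      (c i)%:E * (a n * leb (shadow s (z n) `&` E i)))).
    apply: lee_nneseries => [n _ _|n _]; first by rewrite mule_ge0.
    have [i hi] := key n.
    rewrite setIC; apply: le_trans (lee_wpmul2l (a0 n) hi) _.
    rewrite muleCA.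
    apply: (@nneseries_ge_term _ (fun i => (c i)%:E * (a n * leb (shadow s (z n) `&` E i)))).
    by move=> j; rewrite !mule_ge0// lee_fin.
  rewrite (@nneseries_interchange _ (fun n i => (c i)%:E * (a n * leb (shadow s (z n) `&` E i)))
    xpredT xpredT); last by move=> n i; rewrite !mule_ge0// lee_fin.
  have -> : (C * N * x `^ (1 - q^-1) = (P0 / kk * Kq * N * (18 * x) `^ (1 - q^-1))
      / (1 - 2 `^ (- q^-1)))%R.
    by rewrite powRM// ?(ltW x0)// /C; ring.
  apply: le_trans (geometric_nneseries_le _ y1); last first.
    by rewrite mulr_ge0 ?powR_ge0// ltW// mulr_gt0// mulr_gt0// divr_gt0.
  apply: lee_nneseries => [i _ _|i _].
    by apply: nneseries_ge0 => n _ _; rewrite !mule_ge0// lee_fin.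
  rewrite nneseriesZl; last by move=> n _; rewrite mule_ge0.
  rewrite -integral_shadow_sum//.
  apply: le_trans (lee_wpmul2l _ (weak_integral_le q1 N0 (A0 i)
    (measurable_shadow_sum z a0 s) (shadow_sum_ge0 z a0 s) gw (mEE i) (EA i) (E2 i))) _.
    by rewrite lee_fin.
  rewrite -EFinM lee_fin le_eqVlt; apply/orP; left; apply/eqP.
  have -> : (A i = (18 * x) * 2 ^+ i)%R by rewrite /A; ring.
  rewrite powRM ?exprn_ge0 ?mulr_ge0 ?(ltW x0)//.
  have -> : ((2 ^+ i : R) `^ (1 - q^-1) = 2 ^+ i * (2 `^ (- q^-1)) ^+ i)%R.
    rewrite powRD ?expf_neq0 ?implybT// powRr1 ?exprn_ge0//; congr (_ * _)%R.
    by rewrite -!powR_mulrn ?powR_ge0// -!powRrM mulrC.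
  by rewrite /c -/Kq; field; rewrite expf_neq0//= gt_eqF.
have main' : (lam * x `^ q^-1 <= C * N)%R.
  move: main; rewrite lee_fin => main.
  have xp : (0 < x `^ (1 - q^-1))%R by exact: powR_gt0.
  rewrite -(ler_pM2r xp) -mulrA -powRD ?xN0 ?implybT//.
  by rewrite addrC subrK powRr1// ltW.
rewrite xE lee_fin.
have -> : x = ((x `^ q^-1) `^ q)%R by rewrite -powRrM mulVf ?gt_eqF// powRr1// ltW.
apply: ge0_ler_powR; rewrite ?nnegrE ?powR_ge0 ?(ltW q0)//.
  by rewrite ltW// divr_gt0// mulr_gt0.
by rewrite ler_pdivlMr// mulrC.
Qed.

End ApertureChangeTheorem.

(** * Weak quasinorms: tails, quasi-triangle inequality, monotone limits *)

Section WeakTail.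
Context {R : realType}.
Local Notation leb := (@lebesgue_measure R).
Local Open Scope ereal_scope.
Implicit Types (g : R[i] -> \bar R) (q N M : R).

Lemma le_arc_measure (P Q : set R[i]) :
  (forall th : R, (0 <= th < 2 * pi)%R -> P (circ th) -> Q (circ th)) ->
  arc_measure P <= arc_measure Q.
Proof. by move=> PQ; apply: le_lebesgue => th /= [h] /(PQ _ h). Qed.

Lemma arc_measure_fin_num (P : set R[i]) : arc_measure P \is a fin_num.
Proof.
rewrite ge0_fin_numE//; apply: (@le_lt_trans _ _ (2 * pi)%:E); last exact: ltry.
apply: (@le_trans _ _ (leb `[0%R, (2 * pi)%R[%classic)).
  by apply: le_lebesgue => x /= [h _]; rewrite in_itv.
rewrite lebesgue_measure_itv/=; case: ifPn => _; last by rewrite lee_fin mulr_ge0// pi_ge0.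
by rewrite sube0.
Qed.

Lemma weak_tail_norm q N g : (1 < q)%R -> (0 <= N)%R -> (forall xi, 0 <= g xi) ->
  weak_tail q N g -> weakLq_norm q g <= N%:E.
Proof.
move=> q1 N0 g0 gN; have q0 : (0 < q)%R by rewrite (lt_trans _ q1).
apply: ge_ereal_sup => _ [lam /= lam0 <-].
have := gN lam lam0.
rewrite (_ : [set xi | lam%:E < `|g xi|] = [set xi | lam%:E < g xi]); last first.
  by apply/seteqP; split => xi /=; rewrite gee0_abs.
have fin := arc_measure_fin_num [set xi | lam%:E < g xi].
rewrite -(fineK fin) poweR_EFin -EFinM !lee_fin => le.
have f0 : (0 <= fine (arc_measure [set xi | (lam%:E < g xi)%E]))%R by rewrite fine_ge0.
rewrite mulrC -ler_pdivlMr//.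
apply: le_trans (ge0_ler_powR (ltW _) _ _ le) _; rewrite ?invr_gt0 ?nnegrE ?powR_ge0//.
by rewrite -powRrM mulfV ?gt_eqF// powRr1// divr_ge0// ltW.
Qed.

Lemma weak_norm_tail q N g : (1 < q)%R -> (0 <= N)%R -> (forall xi, 0 <= g xi) ->
  weakLq_norm q g <= N%:E -> weak_tail q N g.
Proof.
move=> q1 N0 g0 gN lam lam0; have q0 : (0 < q)%R by rewrite (lt_trans _ q1).
have : lam%:E * (arc_measure [set xi | lam%:E < `|g xi|]) `^ q^-1 <= N%:E.
  by apply: le_trans gN; apply: ereal_sup_ubound; exists lam.
rewrite (_ : [set xi | lam%:E < `|g xi|] = [set xi | lam%:E < g xi]); last first.
  by apply/seteqP; split => xi /=; rewrite gee0_abs.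
have fin := arc_measure_fin_num [set xi | lam%:E < g xi].
have f0 : (0 <= fine (arc_measure [set xi | (lam%:E < g xi)%E]))%R by rewrite fine_ge0.
rewrite -(fineK fin) poweR_EFin -EFinM !lee_fin => le.
set x := fine _ in f0 le *.
have -> : x = ((x `^ q^-1) `^ q)%R by rewrite -powRrM mulVf ?gt_eqF// powRr1.
apply: ge0_ler_powR; rewrite ?nnegrE ?powR_ge0 ?(ltW q0)//.
  by rewrite divr_ge0// ltW.
by rewrite ler_pdivlMr// mulrC.
Qed.

Lemma weak_norm_lty q g : (1 < q)%R -> (forall xi, 0 <= g xi) ->
  weakLq_norm q g < +oo <-> exists2 N, (0 < N)%R & weak_tail q N g.
Proof.
move=> q1 g0; split; last first.
  by move=> [N N0 /(weak_tail_norm q1 (ltW N0) g0)/le_lt_trans]; apply; exact: ltry.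
move=> glt.
have [K K0 gK] : exists2 K : R, (0 < K)%R & weakLq_norm q g <= K%:E.
  case E : (weakLq_norm q g) glt => [r| |] // _; last by exists 1%R => //; rewrite leNye.
  exists (Num.max r 1)%R; first by rewrite lt_max ltr01 orbT.
  by rewrite lee_fin le_max lexx.
by exists K => //; apply: weak_norm_tail => //; exact: ltW.
Qed.

Lemma weak_tail_le q N M g g' : (0 <= M)%R -> (0 <= N)%R -> (0 < q)%R ->
  (forall th : R, (0 <= th < 2 * pi)%R -> g (circ th) <= M%:E * g' (circ th)) ->
  weak_tail q N g' -> weak_tail q (M * N) g.
Proof.
move=> M0 N0 q0 gg' w lam lam0.
have [M00|MN0] := eqVneq M 0%R.
  rewrite (_ : arc_measure _ = 0) ?lee_fin ?powR_ge0//.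
  rewrite /arc_measure (_ : [set th | _] = set0) ?measure0//.
  apply/seteqP; split => // th /= [/gg' + hl].
  by rewrite M00 mul0e => /(lt_le_trans hl); rewrite lte_fin ltNge (ltW lam0).
have Mp : (0 < M)%R by rewrite lt_neqAle eq_sym MN0.
have lM : (0 < lam / M)%R by rewrite divr_gt0.
have -> : (M * N / lam = N / (lam / M))%R by field; rewrite MN0 gt_eqF.
apply: le_trans (w _ lM); apply: le_arc_measure => th h /= lg.
have := lt_le_trans lg (gg' _ h).
by rewrite muleC -lte_pdivrMr// -EFinM.
Qed.

Variables (z : nat -> R[i]).

Lemma le_cone_sum (a b : nat -> \bar R) s xi : (forall n, 0 <= a n) ->
  (forall n, a n <= b n) -> cone_sum s z a xi <= cone_sum s z b xi.
Proof.
by move=> a0 ab; apply: lee_nneseries => [n _ _|n _]; case: ifP.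
Qed.

Lemma measurable_cone_superlevel (a : nat -> \bar R) s (y : \bar R) :
  (forall n, 0 <= a n) ->
  measurable [set th : R | (0 <= th < 2 * pi)%R /\ y < cone_sum s z a (circ th)].
Proof.
move=> a0.
rewrite (_ : mkset _ = `[0%R, (2 * pi)%R[%classic `&` [set th | y < shadow_sum z a s th]).
  apply: measurableI => //; rewrite -[X in measurable X]setTI.
  by apply: emeasurable_fun_o_infty => //; exact: measurable_shadow_sum.
apply/seteqP; split => th /=; rewrite in_itv/= => -[h1]; rewrite cone_sum_shadow//.
Qed.

(** If the sum exceeds [lam], one summand exceeds lam/2. The 4 is a 2 from this halving times a 2
    from adding two tail bounds, absorbed through 2 <= 2^q. *)
Lemma weak_tail_coneD q N1 N2 s (a1 a2 : nat -> \bar R) :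
  (1 < q)%R -> (0 < N1)%R -> (0 < N2)%R ->
  (forall n, 0 <= a1 n) -> (forall n, 0 <= a2 n) ->
  weak_tail q N1 (cone_sum s z a1) -> weak_tail q N2 (cone_sum s z a2) ->
  weak_tail q (4 * (N1 + N2)) (cone_sum s z (fun n => a1 n + a2 n)).
Proof.
move=> q1 N10 N20 a10 a20 w1 w2 lam lam0.
have q0 : (0 < q)%R by rewrite (lt_trans _ q1).
have l2 : (0 < lam / 2)%R by rewrite divr_gt0.
have sum xi : cone_sum s z (fun n => a1 n + a2 n) xi =
    cone_sum s z a1 xi + cone_sum s z a2 xi.
  rewrite /cone_sum -nneseriesD; last 2 first.
  - by move=> n _ _; case: ifP.
  - by move=> n _ _; case: ifP.
  by apply: eq_eseriesr => n _; case: ifP => // _; rewrite adde0.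
apply: (@le_trans _ _ (arc_measure [set xi | (lam / 2)%:E < cone_sum s z a1 xi] +
    arc_measure [set xi | (lam / 2)%:E < cone_sum s z a2 xi])).
  apply: le_trans (measureU2 leb (measurable_cone_superlevel s _ a10)
    (measurable_cone_superlevel s _ a20)).
  apply: le_lebesgue => th /= [h]; rewrite sum => hl.
  have [h1|h1] := ltP (lam / 2)%:E (cone_sum s z a1 (circ th)); first by left.
  have [h2|h2] := ltP (lam / 2)%:E (cone_sum s z a2 (circ th)); first by right.
  have := lt_le_trans hl (leeD h1 h2); rewrite -EFinD lte_fin; lra.
apply: le_trans (leeD (w1 _ l2) (w2 _ l2)) _; rewrite -EFinD lee_fin.
set u := (2 * (N1 + N2) / lam)%R.
have u0 : (0 < u)%R by rewrite divr_gt0// mulr_gt0// addr_gt0.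
have h1 : ((N1 / (lam / 2)) `^ q <= u `^ q)%R.
  apply: ge0_ler_powR; rewrite ?nnegrE ?(ltW q0) ?(ltW u0) ?(ltW (divr_gt0 N10 l2))//.
  rewrite /u (_ : N1 / (lam / 2) = 2 * N1 / lam)%R; last by field; rewrite gt_eqF.
  by rewrite ler_pM2r ?invr_gt0//; lra.
have h2 : ((N2 / (lam / 2)) `^ q <= u `^ q)%R.
  apply: ge0_ler_powR; rewrite ?nnegrE ?(ltW q0) ?(ltW u0) ?(ltW (divr_gt0 N20 l2))//.
  rewrite /u (_ : N2 / (lam / 2) = 2 * N2 / lam)%R; last by field; rewrite gt_eqF.
  by rewrite ler_pM2r ?invr_gt0//; lra.
apply: le_trans (lerD h1 h2) _.
rewrite (_ : 4 * (N1 + N2) / lam = 2 * u)%R; last by rewrite /u; field; rewrite gt_eqF.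
rewrite powRM ?(ltW u0)//.
have : (2 <= 2 `^ q :> R)%R by apply: le1r_powR; rewrite ?ler1n// ltW.
by have := powR_ge0 u q; nra.
Qed.

(** The classes are added one at a time; the constant grows with J, which is fixed once the test
    functions are chosen. *)
Lemma weak_tail_cone_residues q N s (a : nat -> \bar R) (lev : nat -> nat) J :
  (1 < q)%R -> (0 < N)%R -> (0 < J)%N -> (forall n, 0 <= a n) ->
  (forall j, (j < J)%N ->
    weak_tail q N (cone_sum s z (fun n => if (lev n %% J == j)%N then a n else 0))) ->
  exists2 N', (0 < N')%R & weak_tail q N' (cone_sum s z a).
Proof.
move=> q1 N0 J0 a0 w.
have q0 : (0 < q)%R by rewrite (lt_trans _ q1).
suff H k : (k <= J)%N -> exists2 N', (0 < N')%R &
    weak_tail q N' (cone_sum s z (fun n => if (lev n %% J < k)%N then a n else 0)).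
  have [N' N'0 w'] := H J (leqnn J); exists N' => //.
  rewrite (_ : a = fun n => if (lev n %% J < J)%N then a n else 0)//.
  by apply/funext => n; rewrite ltn_pmod.
elim: k => [|k IH] kJ.
  exists 1%R => // lam lam0.
  rewrite (_ : arc_measure _ = 0) ?lee_fin ?powR_ge0//.
  rewrite /arc_measure (_ : [set th | _] = set0) ?measure0//.
  apply/seteqP; split => // th /= [_]; rewrite /cone_sum eseries0//.
    by rewrite lte_fin ltNge (ltW lam0).
  by move=> n _ _; case: ifP.
have [N' N'0 w'] := IH (ltnW kJ).
exists (4 * (N' + N))%R; first by rewrite mulr_gt0// addr_gt0.
rewrite (_ : (fun n => if (lev n %% J < k.+1)%N then a n else 0) =
    (fun n => (if (lev n %% J < k)%N then a n else 0) +
              (if (lev n %% J == k)%N then a n else 0))); last first.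
  apply/funext => n; rewrite ltnS leq_eqVlt.
  by case: eqVneq => [->|_] /=; rewrite ?ltnn ?adde0 ?add0e.
by apply: weak_tail_coneD => //; [move=> n; case: ifP|move=> n; case: ifP|exact: w].
Qed.

(** Superlevel sets of the truncated sums increase to that of the full sum, and the measure is
    continuous from below. The strict inequality in the tail is what makes them exhaust it. *)
Lemma weak_tail_cone_lim q N s (a : nat -> \bar R) : (forall n, 0 <= a n) ->
  (forall k, weak_tail q N (cone_sum s z (fun n => if (n < k)%N then a n else 0))) ->
  weak_tail q N (cone_sum s z a).
Proof.
move=> a0 w lam lam0.
pose ak k n := if (n < k)%N then a n else 0.
have ak0 k n : 0 <= ak k n by rewrite /ak; case: ifP.
pose F k := [set th : R | (0 <= th < 2 * pi)%R /\ lam%:E < cone_sum s z (ak k) (circ th)].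
have mF k : measurable (F k) by exact: measurable_cone_superlevel.
have Fsub : [set th : R | (0 <= th < 2 * pi)%R /\ lam%:E < cone_sum s z a (circ th)]
    `<=` \bigcup_k F k.
  move=> th /= [h hl]; apply: contrapT => nF.
  move: hl; apply/negP; rewrite -leNgt; apply: nneseries_le_ub => [n|k]; first by case: ifP.
  have : ~ F k th by move=> Fk; apply: nF; exists k.
  move=> /not_andP[//|/negP]; rewrite -leNgt; apply: le_trans.
  apply: (@le_trans _ _ (\sum_(0 <= n < k) if (cabs (circ th - z n) < s * (1 - cabs (z n)))%R
      then ak k n else 0)%R).
    rewrite !big_nat; apply: lee_sum => n /andP[_ nk].
    by rewrite /ak nk.
  by apply: nneseries_lim_ge => n _ _; case: ifP.
apply: le_trans (le_lebesgue Fsub) _.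
have mU : measurable (\bigcup_k F k) by exact: bigcup_measurable.
have ndF : {homo F : n m / (n <= m)%N >-> (n <= m)%O}.
  move=> n m nm; apply/subsetPset => th [h hl]; split => //.
  apply: lt_le_trans hl _; apply: le_cone_sum => // i; rewrite /ak.
  case: ifPn => [ni|_]; last by case: ifP.
  by rewrite (leq_trans ni nm).
have cv := nondecreasing_cvg_mu (mu := leb) mF mU ndF.
rewrite -(cvg_lim _ cv)//; apply: lime_le; first by apply/cvg_ex; eexists; exact: cv.
by apply: nearW => k; exact: w.
Qed.

End WeakTail.

(** * Whitney decomposition of the disk *)

Section Whitney.
Context {R : realType}.
Variable eps : R.
Hypothesis eps0 : 0 < eps.
Implicit Types (n m k : nat) (p w : R * R).

Definition rho k : R := (2 ^+ k)^-1.

Lemma rho_gt0 k : 0 < rho k.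
Proof. by rewrite invr_gt0 exprn_gt0. Qed.

Lemma rhoS k : rho k.+1 = rho k / 2.
Proof. by rewrite /rho exprS invfM mulrC. Qed.

Lemma rho_add k m : rho (k + m) <= rho k.
Proof.
elim: m => [|m IH]; first by rewrite addn0.
by rewrite addnS rhoS; have := rho_gt0 (k + m); lra.
Qed.

Lemma le_rho k m : (k <= m)%N -> rho m <= rho k.
Proof. by move=> /subnKC <-; exact: rho_add. Qed.

Lemma dyadic_level (x : R) : 0 < x <= 1 -> exists k, rho k / 2 < x <= rho k.
Proof.
move=> /andP[x0 x1].
have ex : exists k, rho k / 2 < x.
  exists (Num.truncn x^-1); rewrite -rhoS /rho invf_plt ?posrE ?exprn_gt0//.
  apply: lt_le_trans (truncnS_gt _) _; exact: le_id_pow2.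
case: (ex_minnP ex) => k hk min_k; exists k; rewrite hk/=.
case: k hk min_k => [|k] _ min_k; first by rewrite /rho expr0 invr1.
by rewrite rhoS leNgt; apply/negP => /min_k; rewrite ltnn.
Qed.

(** Triples (level, column, row) are countable, so the pieces become a sequence; a number that
    encodes no triple gets the empty square. *)
Definition whitney_index n : option (nat * int * int) := pickle_inv n.

Definition level n : nat := if whitney_index n is Some q then q.1.1 else 0%N.

Definition grid_square (q : nat * int * int) : set (R * R) :=
  let h := eps * rho q.1.1 in
  `[q.1.2%:~R * h, (q.1.2 + 1)%:~R * h[%classic `*`
  `[q.2%:~R * h, (q.2 + 1)%:~R * h[%classic.

Definition whitney_square n : set (R * R) :=
  if whitney_index n is Some q then grid_square q else set0.

(** Squares of different levels may overlap; cutting by the dyadic annulus yields a partition of the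
    disk. A piece may be a thin sliver of its square, which is why area is measured on the square
    and only [mu] on the piece. *)
Definition whitney_piece n : set (R * R) :=
  whitney_square n `&`
  [set p | rho (level n) / 2 < 1 - cabs (toC p) <= rho (level n)].

(** An empty piece gets the default 0: it is in the disk, and the piece has no mass. *)
Definition whitney_point n : R[i] := toC (xget (0, 0) (whitney_piece n)).

Local Notation T2 := (measurableTypeR R * measurableTypeR R)%type.

Lemma measurable_cabs_affine (a b : R[i]) :
  measurable_fun setT (fun p : T2 => cabs (a + b * toC p)).
Proof.
case: a => a1 a2; case: b => b1 b2.
have m1 : measurable_fun setT (fun p : T2 => a1 + (b1 * p.1 - b2 * p.2)).
  apply: measurable_funD => //; apply: measurable_funB;
  by apply: measurable_funM.
have m2 : measurable_fun setT (fun p : T2 => a2 + (b1 * p.2 + b2 * p.1)).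
  apply: measurable_funD => //; apply: measurable_funD;
  by apply: measurable_funM.
apply: (measurableT_comp (f := @Num.sqrt R)).
  by apply: continuous_measurable_fun => t; exact: sqrt_continuous.
exact: (measurable_funD (measurable_funX 2 m1) (measurable_funX 2 m2)).
Qed.

Lemma measurable_cabs : measurable_fun setT (fun p : T2 => cabs (toC p)).
Proof.
have := measurable_cabs_affine 0 1.
by under eq_fun do rewrite add0r mul1r.
Qed.

Lemma measurable_lt_set (f g : T2 -> R) : measurable_fun setT f ->
  measurable_fun setT g -> measurable [set p : T2 | f p < g p].
Proof.
move=> mf mg; rewrite -[X in measurable X]setTI.
by have := measurable_fun_ltr mf mg measurableT (Y := [set true]); exact.
Qed.

Lemma measurable_grid_square q : measurable (grid_square q : set T2).
Proof. by apply: measurableX; exact: measurable_itv. Qed.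

Lemma measurable_whitney_square n : measurable (whitney_square n : set T2).
Proof.
by rewrite /whitney_square; case: whitney_index => [q|//]; exact: measurable_grid_square.
Qed.

Lemma measurable_whitney_piece n : measurable (whitney_piece n : set T2).
Proof.
apply: measurableI; first exact: measurable_whitney_square.
have m1 : measurable_fun setT (fun p : T2 => 1 - cabs (toC p)).
  by apply: measurable_funB => //; exact: measurable_cabs.
rewrite (_ : mkset _ = [set p : T2 | rho (level n) / 2 < 1 - cabs (toC p)] `&`
   ~` [set p : T2 | rho (level n) < 1 - cabs (toC p)]).
  apply: measurableI; first by apply: measurable_lt_set.
  by apply: measurableC; apply: measurable_lt_set.
apply/seteqP; split => p /=.
- by move=> /andP[h1 h2]; split => //; apply/negP; rewrite -leNgt.
- by move=> [-> /negP]; rewrite -leNgt.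
Qed.

Lemma whitney_square_measure n : whitney_index n ->
  (lebesgue_measure \x lebesgue_measure)%E (whitney_square n : set T2) =
  ((eps * rho (level n)) ^+ 2)%:E.
Proof.
rewrite /whitney_square /level; case: whitney_index => [q|//] _.
rewrite /grid_square product_measure1E; [|exact: measurable_itv|exact: measurable_itv].
have h0 : 0 < eps * rho q.1.1 by rewrite mulr_gt0// rho_gt0.
have itv (i : int) : lebesgue_measure (`[i%:~R * (eps * rho q.1.1),
    (i + 1)%:~R * (eps * rho q.1.1)[%classic : set R) = (eps * rho q.1.1)%:E.
  rewrite lebesgue_measure_itv/= lte_fin ltr_pM2r// ltr_int ltrDl ltr01.
  by rewrite -EFinB -mulrBl intrD addrAC subrr add0r mul1r.
transitivity ((eps * rho q.1.1)%:E * (eps * rho q.1.1)%:E)%E.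
  by congr (_ * _)%E; exact: itv.
by rewrite -EFinM expr2.
Qed.

Lemma whitney_cover p : cabs (toC p) < 1 -> exists n, whitney_piece n p.
Proof.
move=> p1.
have [|k hk] := @dyadic_level (1 - cabs (toC p)).
  by rewrite subr_gt0 p1/= lerBlDr lerDl cabs_ge0.
have h0 : 0 < eps * rho k by rewrite mulr_gt0// rho_gt0.
exists (pickle (k, Num.floor (p.1 / (eps * rho k)), Num.floor (p.2 / (eps * rho k)))).
rewrite /whitney_piece /whitney_square /level /whitney_index pickleK_inv; split => //.
split; rewrite /= in_itv/=.
- by rewrite -ler_pdivlMr// -ltr_pdivrMr// floor_itv.
- by rewrite -ler_pdivlMr// -ltr_pdivrMr// floor_itv.
Qed.

Lemma whitney_square_uniq n m p : level n = level m ->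
  whitney_square n p -> whitney_square m p -> n = m.
Proof.
rewrite /whitney_square /level /whitney_index.
have := @pickle_invK (nat * int * int)%type n; have := @pickle_invK (nat * int * int)%type m.
case: (pickle_inv m) => [[[k i] j]|//] /= <-.
case: (pickle_inv n) => [[[k' i'] j']|//] /= <- kk'; subst k'.
have h0 : 0 < eps * rho k by rewrite mulr_gt0// rho_gt0.
have fl (b : int) (x : R) : x \in `[b%:~R * (eps * rho k), (b + 1)%:~R * (eps * rho k)[ ->
    b = Num.floor (x / (eps * rho k)).
  rewrite in_itv/= -ler_pdivlMr// -ltr_pdivrMr// => h.
  by apply/esym/floor_def.
by move=> [/= /fl -> /fl ->] [/= /fl -> /fl ->].
Qed.

Lemma whitney_square_dist n p w : whitney_square n p -> whitney_square n w ->
  cabs (toC p - toC w) <= 2 * eps * rho (level n).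
Proof.
rewrite /whitney_square /level; case: whitney_index => [[[k i] j]|//] /=.
rewrite /grid_square/= => -[/= p1 p2] [/= w1 w2].
move: p1 p2 w1 w2; rewrite !in_itv/= !intrD !mulrDl !mul1r.
move=> /andP[a1 a2] /andP[b1 b2] /andP[c1 c2] /andP[d1 d2].
apply: le_trans (ler_cabs_ReIm _) _ => /=.
rewrite [leRHS](_ : _ = eps * rho k + eps * rho k); last by rewrite /rho; ring.
by apply: lerD; rewrite ler_norml; apply/andP; split; lra.
Qed.

Lemma whitney_pieceW n p : whitney_piece n p -> whitney_square n p.
Proof. by case. Qed.

Lemma whitney_piece_level n p : whitney_piece n p ->
  rho (level n) / 2 < 1 - cabs (toC p) <= rho (level n).
Proof. by case. Qed.

Lemma whitney_piece_uniq n m p : whitney_piece n p -> whitney_piece m p -> n = m.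
Proof.
move=> [n1 /andP[n2 n3]] [m1 /andP[m2 m3]]; apply: whitney_square_uniq n1 m1.
have [lt|lt|//] := ltngtP (level n) (level m).
- by exfalso; have := le_rho lt; rewrite rhoS; lra.
- by exfalso; have := le_rho lt; rewrite rhoS; lra.
Qed.

Lemma whitney_point_piece n p : whitney_piece n p ->
  exists2 w, whitney_piece n w & whitney_point n = toC w.
Proof.
move=> np; exists (xget (0, 0) (whitney_piece n)) => //.
by apply: xgetPex; exists p.
Qed.

Lemma whitney_point_disk n : cabs (whitney_point n) < 1.
Proof.
rewrite /whitney_point; case: xgetP => [p -> /whitney_piece_level|_].
  by have := rho_gt0 (level n); lra.
by rewrite (_ : toC _ = 0)// cabs0.
Qed.

Lemma whitney_index_piece n p : whitney_piece n p -> whitney_index n.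
Proof. by move=> []; rewrite /whitney_square; case: whitney_index. Qed.

(** As 2 eps <= 1/4, moving inside the square changes the height by at most rho/4. *)
Lemma whitney_square_height n p w : eps <= 8^-1 -> whitney_piece n p ->
  whitney_square n w -> rho (level n) / 4 <= 1 - cabs (toC w) < 2 * rho (level n).
Proof.
move=> e8 pn wn.
have := whitney_square_dist (whitney_pieceW pn) wn.
have /andP[] := whitney_piece_level pn.
have := rho_gt0 (level n).
have := cabs_le_dist (toC p) (toC w); have := cabs_le_dist (toC w) (toC p).
rewrite (cabs_distC (toC w)); set d := cabs (_ - _); set r := rho _.
move=> h1 h2 r0 h3 h4 h5.
have : 2 * eps * r <= r / 4 by nra.
by move=> h6; apply/andP; split; lra.
Qed.

(** Distinct levels congruent mod J differ by at least 3, so the rho differ by a factor 8 and the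
    height ranges [rho/4, 2 rho) do not meet. *)
Lemma whitney_squares_disjoint n m p p' w J : eps <= 8^-1 -> (2 < J)%N ->
  level n = level m %[mod J] -> whitney_piece n p -> whitney_piece m p' ->
  whitney_square n w -> whitney_square m w -> n = m.
Proof.
move=> e8 J2 nmJ np mp' nw mw; apply: (whitney_square_uniq _ nw mw).
have /andP[a1 a2] := whitney_square_height e8 np nw.
have /andP[b1 b2] := whitney_square_height e8 mp' mw.
have step k l : (k < l)%N -> k = l %[mod J] -> rho l <= rho k / 8.
  move=> kl /eqP; rewrite eq_sym eqn_mod_dvd ?(ltnW kl)// => /dvdn_leq.
  rewrite subn_gt0 => /(_ kl) Jkl.
  have : (k + 3 <= l)%N by rewrite -leq_subRL ?(ltnW kl)// (leq_trans J2).
  by move=> /le_rho; rewrite addnC !addSn add0n !rhoS; lra.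
have rn := rho_gt0 (level n); have rm := rho_gt0 (level m).
have [lt|lt|//] := ltngtP (level n) (level m).
- by exfalso; have := step _ _ lt nmJ; lra.
- by exfalso; have := step _ _ lt (esym nmJ); lra.
Qed.

(** Moving from p to the chosen point costs 2 eps rho, and the factor 2 comes from rho < 2 (1 -
    |z_n|). *)
Lemma shadow_of_cone n p th (sigma : R) : 0 < sigma -> whitney_piece n p ->
  cabs (circ th - toC p) < sigma * (1 - cabs (toC p)) ->
  cabs (circ th - whitney_point n) < 2 * (sigma + 2 * eps) * (1 - cabs (whitney_point n)).
Proof.
move=> s0 np hc; have [w nw ->] := whitney_point_piece np.
have D := whitney_square_dist (whitney_pieceW np) (whitney_pieceW nw).
have := cabs_dist_triangle (toC p) (circ th) (toC w).
have /andP[p1 p2] := whitney_piece_level np.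
have /andP[w1 w2] := whitney_piece_level nw.
move: (cabs (circ th - toC w)) (cabs (circ th - toC p)) (cabs (toC p - toC w)) D hc.
move: (rho (level n)) p1 p2 w1 w2 => r p1 p2 w1 w2 A B D' D hc tri.
have h1 : sigma * (1 - cabs (toC p)) <= sigma * r by rewrite ler_pM2l.
have h2 : (sigma + 2 * eps) * r < (sigma + 2 * eps) * (2 * (1 - cabs (toC w))).
  by rewrite ltr_pM2l ?addr_gt0 ?mulr_gt0//; lra.
by lra.
Qed.

(** The displacement 2 eps rho counts once for the distance and s times for the height; with rho <=
    4 (1 - |w|) this is the loss 8 eps (s + 1). *)
Lemma cone_of_shadow n p w th (s sigma : R) : eps <= 8^-1 -> 1 < s ->
  s + 8 * eps * (s + 1) <= sigma -> whitney_piece n p -> whitney_square n w ->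
  cabs (circ th - whitney_point n) < s * (1 - cabs (whitney_point n)) ->
  lusin_cone sigma (circ th) w.
Proof.
have e0 := eps0; move=> e8 s1 ssig np nw.
have [z nz ->] := whitney_point_piece np => hs.
have /andP[b1 b2] := whitney_square_height e8 np nw.
have r0 := rho_gt0 (level n).
split; first by lra.
rewrite cone_dist.
have := whitney_square_dist (whitney_pieceW nz) nw.
have := cabs_dist_triangle (toC z) (circ th) (toC w).
have := cabs_le_dist (toC w) (toC z); rewrite (cabs_distC (toC w)).
move: (cabs (circ th - toC w)) (cabs (circ th - toC z)) (cabs (toC z - toC w)) hs.
move: (rho (level n)) b1 b2 r0 => r b1 b2 r0 A B D hs h1 h2 h3.
have h4 : s * (1 - cabs (toC z)) <= s * (1 - cabs (toC w) + D) by rewrite ler_pM2l; lra.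
have h5 : (s + 1) * D <= (s + 1) * (2 * eps * r) by rewrite ler_pM2l; lra.
have h6 : (2 * eps * (s + 1)) * r <= (2 * eps * (s + 1)) * (4 * (1 - cabs (toC w))).
  by rewrite ler_wpM2l ?mulr_ge0//; lra.
have h7 : (s + 8 * eps * (s + 1)) * (1 - cabs (toC w)) <= sigma * (1 - cabs (toC w)).
  by rewrite ler_wpM2r//; lra.
by lra.
Qed.

End Whitney.

(** * Powers of comparable numbers *)

Section PowerComparison.
Context {R : realType}.
Implicit Types x y e L : R.

Lemma powR_comparable x y e L : 0 < y -> 1 <= L -> y / L <= x <= L * y ->
  x `^ e <= L `^ `|e| * y `^ e.
Proof.
move=> y0 L1 /andP[h1 h2].
have L0 : 0 < L by lra.
have yL : 0 < y / L by rewrite divr_gt0.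
have x0 : 0 < x by exact: lt_le_trans h1.
case: (ger0P e) => e0.
  rewrite -powRM ?(ltW L0) ?(ltW y0)//.
  by apply: ge0_ler_powR; rewrite ?nnegrE ?(ltW x0) ?mulr_ge0 ?(ltW L0) ?(ltW y0).
have yLx : y `^ (- e) <= L `^ (- e) * x `^ (- e).
  rewrite -powRM ?(ltW L0) ?(ltW x0)//.
  apply: ge0_ler_powR; rewrite ?nnegrE ?oppr_ge0 ?(ltW e0) ?(ltW y0) ?mulr_ge0 ?(ltW L0) ?(ltW x0)//.
  by rewrite mulrC -ler_pdivrMr.
rewrite -{1 3}[e]opprK (powRN x) (powRN y) -[leLHS]mul1r.
by rewrite ler_pdivrMr ?powR_gt0// mulrAC ler_pdivlMr ?powR_gt0// mul1r.
Qed.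

End PowerComparison.

(** * Euclidean size of Bergman disks *)

Section BergmanDisk.
Context {R : realType}.
Implicit Types (z w : R[i]) (tau x : R).

(** This is tanh tau, the pseudohyperbolic radius of a Bergman disk of radius [tau]. *)
Definition tanh_radius tau : R := (expR (2 * tau) - 1) / (expR (2 * tau) + 1).

Lemma tanh_radius_bounds tau : 0 < tau -> 0 < tanh_radius tau < 1.
Proof.
move=> t0; have e1 : 1 < expR (2 * tau) by rewrite expR_gt1 mulr_gt0.
have e2 : 0 < expR (2 * tau) + 1 by lra.
by rewrite /tanh_radius divr_gt0 ?subr_gt0//= ltr_pdivrMr// mul1r; lra.
Qed.

Lemma half_ln_lt tau x : 0 <= x < 1 ->
  (2^-1 * ln ((1 + x) / (1 - x)) < tau) = (x < tanh_radius tau).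
Proof.
move=> /andP[x0 x1].
have d0 : 0 < 1 - x by lra.
have n0 : 0 < (1 + x) / (1 - x) by rewrite divr_gt0//; lra.
have E0 := expR_gt0 (2 * tau).
rewrite mulrC ltr_pdivrMr// (mulrC tau) -[X in _ < X]expRK ltr_ln ?posrE ?expR_gt0//.
rewrite /tanh_radius ltr_pdivrMr// ltr_pdivlMr ?addr_gt0//.
by apply/idP/idP => h; lra.
Qed.

Lemma cabs_moebius z w :
  cabs (1 - conjc w * z) ^+ 2 - cabs (w - z) ^+ 2 = (1 - cabs w ^+ 2) * (1 - cabs z ^+ 2).
Proof. by rewrite !sqr_cabs; case: z => a b; case: w => c d /=; ring. Qed.

Lemma cabs_moebius_lt z w : cabs z < 1 -> cabs w < 1 ->
  cabs (w - z) < cabs (1 - conjc w * z).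
Proof.
move=> z1 w1; rewrite -ltr_sqr ?nnegrE ?cabs_ge0// -subr_gt0 cabs_moebius.
by rewrite mulr_gt0// subr_gt0 expr_lt1// cabs_ge0.
Qed.

Lemma bergman_dist_lt z w tau : cabs z < 1 -> cabs w < 1 ->
  (bergman_dist z w < tau) =
  (cabs (w - z) < tanh_radius tau * cabs (1 - conjc w * z)).
Proof.
move=> z1 w1; have mo := cabs_moebius_lt z1 w1.
have d0 : 0 < cabs (1 - conjc w * z) by exact: le_lt_trans (cabs_ge0 _) mo.
rewrite /bergman_dist half_ln_lt /phi cabsM cabsV.
  by rewrite ltr_pdivrMr.
by rewrite divr_ge0 ?cabs_ge0//= ltr_pdivrMr// mul1r.
Qed.

(** The denominator of the Moebius map is at least 1 - |z| in modulus. *)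
Lemma bergman_disk_near z w tau : 0 < tau -> cabs z < 1 -> cabs w < 1 ->
  cabs (w - z) < tanh_radius tau * (1 - cabs z) -> bergman_dist z w < tau.
Proof.
move=> t0 z1 w1 h; rewrite bergman_dist_lt//; apply: lt_le_trans h _.
have /andP[r0 _] := tanh_radius_bounds t0.
rewrite ler_wpM2l ?(ltW r0)//.
have := cabs_ge_dist 1 (- (conjc w * z)); rewrite cabs1 cabsN cabsM cabs_conj.
by have := cabs_ge0 z; have := cabs_ge0 w; nra.
Qed.

(** Writing 1 - conj(w) z = (1 - |z|^2) + conj(z - w) z bounds |w - z| by eta (2 (1 - |z|) + |w -
    z|), which is solved for |w - z|. *)
Lemma bergman_dist_Euclid z w tau : 0 < tau -> cabs z < 1 -> cabs w < 1 ->
  bergman_dist z w < tau ->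
  cabs (w - z) <= 2 * tanh_radius tau / (1 - tanh_radius tau) * (1 - cabs z).
Proof.
move=> t0 z1 w1; rewrite bergman_dist_lt//.
have /andP[] := tanh_radius_bounds t0; set eta := tanh_radius tau => r0 r1 h.
have id : 1 - conjc w * z = Complex (1 - cabs z ^+ 2) 0 + conjc (z - w) * z.
  rewrite sqr_cabs; case: (z) (w) => a b [c d].
  by apply/eqP; rewrite eq_complex /=; apply/andP; split; apply/eqP; ring.
have c0 := cabs_ge0 z.
have z2 : 0 <= 1 - cabs z ^+ 2 by rewrite subr_ge0 expr_le1// ltW.
have : cabs (1 - conjc w * z) <= (1 - cabs z ^+ 2) + cabs (w - z) * cabs z.
  by rewrite id; apply: le_trans (cabsD _ _) _; rewrite cabs_real// cabsM cabs_conj cabs_distC.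
have := cabs_ge0 (w - z).
move: (cabs (w - z)) (cabs (1 - conjc w * z)) h => D M h D0 M1.
rewrite mulrAC ler_pdivlMr ?subr_gt0//.
have h1 : eta * M <= eta * (1 - cabs z ^+ 2 + D * cabs z) by rewrite ler_pM2l.
have h2 : D * cabs z <= D by rewrite ler_piMr// ltW.
have h3 : 1 - cabs z ^+ 2 <= 2 * (1 - cabs z) by rewrite expr2; nra.
have h4 : eta * (1 - cabs z ^+ 2 + D * cabs z) <= eta * (2 * (1 - cabs z) + D).
  by rewrite ler_pM2l//; lra.
by lra.
Qed.

Lemma bergman_distC z w : cabs z < 1 -> cabs w < 1 -> bergman_dist z w = bergman_dist w z.
Proof.
move=> z1 w1; rewrite /bergman_dist /phi !cabsM !cabsV (cabs_distC w).
suff -> : cabs (1 - conjc w * z) = cabs (1 - conjc z * w) by [].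
by rewrite -cabs_conj; congr cabs; case: (z) (w) => a b [c d];
  apply/eqP; rewrite eq_complex /=; apply/andP; split; apply/eqP; ring.
Qed.

Lemma measurable_bergman_disk w tau : cabs w < 1 ->
  measurable (bergman_disk w tau : set (measurableTypeR R * measurableTypeR R)).
Proof.
move=> w1.
rewrite (_ : bergman_disk w tau = [set p | cabs (toC p) < 1] `&`
  [set p | cabs (w + (-1) * toC p) < tanh_radius tau * cabs (1 + (- conjc w) * toC p)]).
  apply: measurableI; apply: measurable_lt_set => //.
  - exact: measurable_cabs.
  - exact: measurable_cabs_affine.
  - by apply: measurable_funM => //; exact: measurable_cabs_affine.
apply/seteqP; split => p /= [p1]; rewrite mulN1r mulNr.
- by rewrite bergman_dist_lt.
- by split => //; rewrite bergman_dist_lt.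
Qed.

End BergmanDisk.

(** * Comparison of the two cone integrals with the discrete sum *)

Section ConeIntegrals.
Context {R : realType}.
Variable (mu : {measure set (measurableTypeR R * measurableTypeR R)%type -> \bar R}).
Variables (beta t sigma eps : R).
Hypotheses (sigma1 : 1 < sigma) (eps0 : 0 < eps).
Implicit Types (f : R[i] -> R[i]) (th v : R) (p w : R * R).

(** The power of the height left in both integrals: t - 1 with |f| counted as height^(-beta), and on
    the area side the exponent gam - 2 once a square of area of order rho^2 is integrated. *)
Let gam : R := t - 1 - beta.
Local Notation zc := (whitney_point eps).

Definition whitney_mass n : \bar R :=
  ((rho (level n) `^ gam)%:E * mu (whitney_piece eps n))%E.

Definition mu_cone_integral f (xi : R[i]) : \bar R :=
  (\int[mu]_(p in lusin_cone sigma xi)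
     ((1 - cabs (toC p)) `^ t * cabs (f (toC p)) / (1 - cabs (toC p)))%:E)%E.

Definition area_cone_integral tau (xi : R[i]) : \bar R :=
  area_integral (lusin_cone sigma xi) (fun p =>
    ((1 - cabs (toC p)) `^ (t - 1) * (1 - cabs (toC p)) `^ (- beta)
       / (1 - cabs (toC p)) ^+ 2)%:E * mu (bergman_disk (toC p) tau))%E.

Lemma whitney_mass_ge0 n : (0 <= whitney_mass n)%E.
Proof. by rewrite mule_ge0// lee_fin powR_ge0. Qed.

Lemma mu_integrand_ge0 f p : cabs (toC p) < 1 ->
  0 <= (1 - cabs (toC p)) `^ t * cabs (f (toC p)) / (1 - cabs (toC p)).
Proof.
by move=> p1; rewrite divr_ge0 ?mulr_ge0 ?powR_ge0 ?cabs_ge0// subr_ge0 ltW.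
Qed.

Lemma mu_cone_integral_ge0 f xi : (0 <= mu_cone_integral f xi)%E.
Proof.
by apply: integral_ge0 => p [p1 _]; rewrite lee_fin mu_integrand_ge0.
Qed.

Lemma area_integrand_ge0 v : 0 <= v `^ (t - 1) * v `^ (- beta) / v ^+ 2.
Proof. by rewrite divr_ge0 ?sqr_ge0// mulr_ge0 ?powR_ge0. Qed.

Lemma area_cone_integral_ge0 tau xi : (0 <= area_cone_integral tau xi)%E.
Proof.
rewrite mule_ge0 ?lee_fin ?invr_ge0 ?pi_ge0//.
by apply: integral_ge0 => p _; rewrite mule_ge0// lee_fin area_integrand_ge0.
Qed.

Lemma powR_density v (F : R) : 0 < v -> v `^ t * F / v = v `^ gam * (F * v `^ beta).
Proof.
move=> v0; have vN : v != 0 by rewrite gt_eqF.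
have -> : t = gam + 1 + beta by rewrite /gam; ring.
rewrite powRD ?vN ?implybT// powRD ?vN ?implybT// powRr1 ?(ltW v0)//.
by field.
Qed.

Lemma powR_area_density v : 0 < v ->
  v `^ (t - 1) * v `^ (- beta) / v ^+ 2 = v `^ (gam - 2).
Proof.
move=> v0; have vN : v != 0 by rewrite gt_eqF.
rewrite -powRD ?vN ?implybT// -powR_mulrn ?(ltW v0)// -powRB ?vN ?implybT//.
Qed.

Lemma mu_cone_upper f (M : R) th : 0 <= M ->
  (forall z, cabs z < 1 -> cabs (f z) * (1 - cabs z) `^ beta <= M) ->
  (mu_cone_integral f (circ th) <=
   (M * 2 `^ `|gam|)%:E * cone_sum (2 * (sigma + 2 * eps)) zc whitney_mass (circ th))%E.
Proof.
move=> M0 fM; set s' := 2 * (sigma + 2 * eps).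
have s0 : 0 < sigma by rewrite (lt_trans _ sigma1).
pose cond n := cabs (circ th - zc n) < s' * (1 - cabs (zc n)).
pose c n : \bar R := if cond n then (M * 2 `^ `|gam| * rho (level n) `^ gam)%:E else 0%E.
have c0 n : (0 <= c n)%E by rewrite /c; case: ifP => // _; rewrite lee_fin !mulr_ge0 ?powR_ge0.
have mW n := @measurable_whitney_piece R eps n.
rewrite /mu_cone_integral.
apply: (@le_trans _ _ (\sum_(0 <= n <oo) c n * mu (whitney_piece eps n))%E).
  apply: (integral_cover_le mu c0 mW) => p [p1 hp].
    by rewrite lee_fin mu_integrand_ge0.
  have [n np] := whitney_cover eps0 p1.
  have v0 : 0 < 1 - cabs (toC p) by rewrite subr_gt0.
  have cn : cond n by rewrite cone_dist in hp; exact: shadow_of_cone hp.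
  apply: le_trans (nneseries_ge_term n _); last by move=> i; rewrite mule_ge0// lee_fin.
  rewrite indicE mem_set// mule1 /c cn lee_fin powR_density//.
  have /andP[l1 l2] := whitney_piece_level np.
  have r0 := @rho_gt0 R (level n).
  rewrite mulrC -mulrA ler_pM ?mulr_ge0 ?powR_ge0 ?cabs_ge0//; first exact: fM.
  by apply: powR_comparable => //; rewrite ?ler1n//; apply/andP; split; lra.
rewrite /cone_sum -nneseriesZl; last first.
  by move=> n _; case: ifP => // _; exact: whitney_mass_ge0.
apply: lee_nneseries => [n _ _|n _]; first by rewrite mule_ge0.
rewrite /c /cond; case: ifP => _; last by rewrite mul0e mule0.
by rewrite /whitney_mass muleA -EFinM.
Qed.

(** [P] selects the pieces on which f is large. Pieces are disjoint, so at each point at most one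
    term of the minorant survives. *)
Lemma mu_cone_lower f (s c : R) (P : pred nat) th : 0 < c -> eps <= 8^-1 -> 1 < s ->
  s + 8 * eps * (s + 1) <= sigma ->
  (forall n p, P n -> whitney_piece eps n p ->
     c * rho (level n) `^ (- beta) <= cabs (f (toC p))) ->
  ((c / 2 `^ `|t - 1|)%:E * cone_sum s zc (fun n => if P n then whitney_mass n else 0%E) (circ th)
   <= mu_cone_integral f (circ th))%E.
Proof.
move=> c0 e8 s1 ss fc.
pose cond n := cabs (circ th - zc n) < s * (1 - cabs (zc n)).
have k0 : 0 <= c / 2 `^ `|t - 1| by rewrite divr_ge0 ?powR_ge0// ltW.
pose cc n : \bar R := if P n && cond n then
  (c / 2 `^ `|t - 1| * rho (level n) `^ gam)%:E else 0%E.
have cc0 n : (0 <= cc n)%E by rewrite /cc; case: ifP => // _; rewrite lee_fin mulr_ge0 ?powR_ge0.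
have mW n := @measurable_whitney_piece R eps n.
apply: (@le_trans _ _ (\sum_(0 <= n <oo) cc n * mu (whitney_piece eps n))%E).
  rewrite /cone_sum -nneseriesZl; last first.
    by move=> n _; case: ifP => // _; case: ifP => // _; exact: whitney_mass_ge0.
  apply: lee_nneseries => [n _ _|n _].
    rewrite mule_ge0 ?lee_fin//; case: ifP => // _; case: ifP => // _.
    exact: whitney_mass_ge0.
  rewrite /cc /cond; case: ifP => hc; rewrite ?andbT ?andbF; last by rewrite mule0 mul0e.
  case: (P n); last by rewrite mule0 mul0e.
  by rewrite /whitney_mass muleA -EFinM.
apply: (integral_pack_ge mu cc0 mW).
- by move=> p [p1 _]; rewrite lee_fin mu_integrand_ge0.
- move=> n; rewrite /cc; case: ifP; last by rewrite eqxx.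
  move=> /andP[_ cn] _ p np.
  by apply: (cone_of_shadow eps0 e8 s1 ss np (whitney_pieceW np) cn).
- move=> p [p1 _].
  have [n np] := whitney_cover eps0 p1.
  have v0 : 0 < 1 - cabs (toC p) by rewrite subr_gt0.
  rewrite (nneseriesD1 (n := n))//; last by move=> k _; rewrite mule_ge0// lee_fin.
  rewrite eseries0 ?adde0; last first.
    move=> k _ /andP[_ kn]; rewrite indicE memNset ?mule0// => kp.
    by move: kn; rewrite (whitney_piece_uniq eps0 kp np) eqxx.
  rewrite indicE mem_set// mule1 /cc; case: ifP => [/andP[Pn _]|_]; last first.
    by rewrite lee_fin mu_integrand_ge0.
  rewrite lee_fin.
  have /andP[l1 l2] := whitney_piece_level np.
  have r0 := @rho_gt0 R (level n).
  have rN : rho (level n) != 0 :> R by rewrite gt_eqF.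
  have vN : 1 - cabs (toC p) != 0 by rewrite gt_eqF.
  have -> : (1 - cabs (toC p)) `^ t * cabs (f (toC p)) / (1 - cabs (toC p)) =
      (1 - cabs (toC p)) `^ (t - 1) * cabs (f (toC p)).
    by rewrite powRB ?vN ?implybT// powRr1 ?(ltW v0)//; ring.
  have h1 : rho (level n) `^ (t - 1) <= 2 `^ `|t - 1| * (1 - cabs (toC p)) `^ (t - 1).
    by apply: powR_comparable => //; rewrite ?ler1n//; apply/andP; split; lra.
  have h2 := fc n p Pn np.
  have -> : gam = (t - 1) + (- beta) by [].
  rewrite powRD ?rN ?implybT//.
  rewrite (_ : c / _ * _ = (rho (level n) `^ (t - 1) / 2 `^ `|t - 1|) *
    (c * rho (level n) `^ (- beta))); last by ring.
  apply: ler_pM => //.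
  + by rewrite divr_ge0 ?powR_ge0.
  + by rewrite mulr_ge0 ?powR_ge0 ?ltW.
  + by rewrite ler_pdivrMr ?powR_gt0// mulrC.
Qed.

Local Notation leb2 := (@lebesgue_measure R \x @lebesgue_measure R)%E.

(** For w in the square of a piece, the Bergman disk at w contains the piece, since 2 eps rho <=
    tanh(tau) rho/2. Within one residue class the squares of nonempty pieces are disjoint, so these
    contributions add up. *)
Lemma area_cone_lower (s tau : R) (J : nat) : eps <= 8^-1 -> 1 < s -> 0 < tau ->
  s + 8 * eps * (s + 1) <= sigma -> 4 * eps <= tanh_radius tau -> (2 < J)%N ->
  exists2 K : R, 0 < K & forall j th,
    (K%:E * cone_sum s zc (fun n => if (level n %% J == j)%N then whitney_mass n else 0%E) (circ th)
     <= area_cone_integral tau (circ th))%E.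
Proof.
move=> e8 s1 tau0 ss et J2.
(* Heights in the square lie between rho/4 and 2 rho. *)
pose L : R := (4 `^ `|gam - 2|)^-1.
have L0 : 0 < L by rewrite invr_gt0 powR_gt0.
exists (pi^-1 * (L * eps ^+ 2)); first by rewrite !mulr_gt0 ?invr_gt0 ?pi_gt0// exprn_gt0.
move=> j th.
pose cond n := cabs (circ th - zc n) < s * (1 - cabs (zc n)).
pose cc n : \bar R := (if (level n %% J == j)%N && cond n then
  (L * rho (level n) `^ (gam - 2))%:E * mu (whitney_piece eps n) else 0)%E.
have cc0 n : (0 <= cc n)%E.
  by rewrite /cc; case: ifP => // _; rewrite mule_ge0// lee_fin mulr_ge0 ?powR_ge0 ?(ltW L0).
have mR n := @measurable_whitney_square R eps n.
rewrite EFinM -muleA /area_cone_integral /area_integral.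
apply: lee_wpmul2l; first by rewrite lee_fin invr_ge0 pi_ge0.
have cc_piece n : cc n != 0%E -> [/\ (level n %% J == j)%N, cond n & whitney_piece eps n !=set0].
  rewrite /cc; case: ifP; last by rewrite eqxx.
  move=> /andP[h1 h2] h3; split => //; apply/set0P; apply: contra_neq h3 => ->.
  by rewrite measure0 mule0.
apply: (@le_trans _ _ (\sum_(0 <= n <oo) cc n * leb2 (whitney_square eps n))%E).
  rewrite /cone_sum -nneseriesZl; last first.
    by move=> n _; case: ifP => // _; case: ifP => // _; exact: whitney_mass_ge0.
  apply: lee_nneseries => [n _ _|n _].
    rewrite mule_ge0 ?lee_fin ?mulr_ge0 ?exprn_ge0 ?(ltW L0) ?(ltW eps0)//.
    by case: ifP => // _; case: ifP => // _; exact: whitney_mass_ge0.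
  (* As L rho^(gam-2) is positive, a zero coefficient means a failed condition or a piece of measure
     0; the term on the left then vanishes too. *)
  have [c00|/cc_piece[hj hcn [p np]]] := eqVneq (cc n) 0%E.
    rewrite c00 mul0e; move: c00; rewrite /cc -/(cond n).
    case: (cond n) => /=; last by rewrite mule0.
    case: (level n %% J == j)%N => /=; last by rewrite mule0.
    move=> /eqP; rewrite mule_eq0 => /orP[|/eqP m0].
      by rewrite eqe gt_eqF// mulr_gt0 ?powR_gt0 ?rho_gt0.
    by rewrite /whitney_mass m0 !mule0.
  rewrite whitney_square_measure ?(whitney_index_piece np)//.
  rewrite ifT// /cc hj hcn /= /whitney_mass.
  rewrite muleAC -!EFinM muleA -EFinM.
  apply: lee_wpmul2r => //; rewrite lee_fin.
  have r0 := @rho_gt0 R (level n).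
  have rN : rho (level n) != 0 :> R by rewrite gt_eqF.
  have -> : gam = (gam - 2) + 2%:R by ring.
  rewrite powRD ?rN ?implybT// powR_mulrn ?(ltW r0)// addrK exprMn.
  by rewrite le_eqVlt; apply/orP; left; apply/eqP; ring.
apply: (integral_pack_ge leb2 cc0 mR).
- by move=> p _; rewrite mule_ge0// lee_fin area_integrand_ge0.
- move=> n /cc_piece[_ cn [p np]] w nw.
  exact: (cone_of_shadow eps0 e8 s1 ss np nw cn).
- move=> w [w1 _].
  have g0 : (0 <= ((1 - cabs (toC w)) `^ (t - 1) * (1 - cabs (toC w)) `^ (- beta)
       / (1 - cabs (toC w)) ^+ 2)%:E * mu (bergman_disk (toC w) tau))%E.
    by rewrite mule_ge0// lee_fin area_integrand_ge0.
  have [all0|] := pselect (forall n, (cc n * (\1_(whitney_square eps n) w)%:E)%E = 0%E).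
    by rewrite eseries0.
  move=> /existsNP[n nz].
  have nw : whitney_square eps n w.
    by apply: contrapT => h; apply: nz; rewrite indicE memNset// mule0.
  have cn0 : cc n != 0%E by apply/eqP => h; apply: nz; rewrite h mul0e.
  have [hj hcn [p np]] := cc_piece n cn0.
  rewrite (nneseriesD1 (n := n))//; last by move=> k _; rewrite mule_ge0// lee_fin.
  rewrite eseries0 ?adde0; last first.
    move=> k _ /andP[_ kn]; have [->|/cc_piece[hj' _ [p' kp']]] := eqVneq (cc k) 0%E.
      by rewrite mul0e.
    rewrite indicE memNset ?mule0// => kw; move/eqP: kn; apply.
    apply: (whitney_squares_disjoint eps0 e8 J2 _ kp' np kw nw).
    by rewrite (eqP hj) (eqP hj').
  rewrite indicE mem_set// mule1 /cc hj hcn /=.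
  have /andP[a1 a2] := whitney_square_height e8 np nw.
  have r0 := @rho_gt0 R (level n).
  have v0 : 0 < 1 - cabs (toC w) by rewrite subr_gt0.
  rewrite powR_area_density//.
  apply: lee_pmul => //; first by rewrite lee_fin mulr_ge0 ?powR_ge0 ?(ltW L0).
    rewrite lee_fin mulrC ler_pdivrMr ?powR_gt0// mulrC.
    by apply: powR_comparable => //; rewrite ?ler1n//; apply/andP; split; lra.
  apply: le_measure; rewrite ?inE.
  + exact: measurable_whitney_piece.
  + exact: measurable_bergman_disk.
  move=> z nz'.
  have /andP[b1 b2] := whitney_piece_level nz'.
  have z1 : cabs (toC z) < 1 by lra.
  split => //; apply: bergman_disk_near => //.
  apply: le_lt_trans (whitney_square_dist nw (whitney_pieceW nz')) _.
  have /andP[t0 _] := tanh_radius_bounds tau0.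
  have h1 : 2 * eps * rho (level n) <= tanh_radius tau * (rho (level n) / 2).
    have : (4 * eps) * rho (level n) <= tanh_radius tau * rho (level n) by rewrite ler_pM2r.
    by lra.
  by apply: le_lt_trans h1 _; rewrite ltr_pM2l.
Qed.

(** For fixed w the disk D(w, tau) is split into its traces on the pieces. If it meets a piece, w
    lies in a box of side 2 M rho around the chosen point, and that point sees [th] at aperture
    s'. *)
Lemma area_cone_upper (tau : R) : 0 < tau ->
  exists2 s', 1 < s' & exists2 K : R, 0 < K & forall th,
    (area_cone_integral tau (circ th) <= K%:E * cone_sum s' zc whitney_mass (circ th))%E.
Proof.
move=> tau0.
have /andP[eta0 eta1] := tanh_radius_bounds tau0.
set eta := tanh_radius tau in eta0 eta1.
pose k := 2 * eta / (1 - eta).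
have k0 : 0 < k by apply: divr_gt0; [rewrite mulr_gt0|rewrite subr_gt0].
pose s' := 2 * (sigma * (1 + k) + k + 2 * eps).
have s0 := sigma1; have e0 := eps0.
have s'1 : 1 < s'.
  have : 0 < sigma * k by rewrite mulr_gt0//; lra.
  by rewrite /s'; lra.
exists s' => //.
pose M := k + 2 * eps.
have M0 : 0 < M by rewrite addr_gt0// mulr_gt0.
(* [d1] gives 1 - |w| <= (1 + k) rho, and [d2] gives rho/2 < (1 + k)(1 - |w|). *)
pose L := 2 * (1 + k).
have L1 : 1 <= L by rewrite /L; lra.
pose KL := L `^ `|gam - 2|.
have KL0 : 0 < KL by rewrite powR_gt0//; lra.
exists (pi^-1 * (KL * (2 * M) ^+ 2)).
  by rewrite !mulr_gt0 ?invr_gt0 ?pi_gt0// exprn_gt0// mulr_gt0.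
move=> th.
pose cond n := cabs (circ th - zc n) < s' * (1 - cabs (zc n)).
pose c n : \bar R := (if cond n then
  (KL * rho (level n) `^ (gam - 2))%:E * mu (whitney_piece eps n) else 0)%E.
have c0 n : (0 <= c n)%E.
  by rewrite /c; case: ifP => // _; rewrite mule_ge0// lee_fin mulr_ge0 ?powR_ge0 ?(ltW KL0).
pose U n : set (R * R) :=
  `[complex.Re (zc n) - M * rho (level n), complex.Re (zc n) + M * rho (level n)]%classic `*`
  `[complex.Im (zc n) - M * rho (level n), complex.Im (zc n) + M * rho (level n)]%classic.
have mU n : measurable (U n : set (measurableTypeR R * measurableTypeR R)).
  by apply: measurableX; exact: measurable_itv.
have lebU n : leb2 (U n) = ((2 * M * rho (level n)) ^+ 2)%:E.
  rewrite product_measure1E; [|exact: measurable_itv|exact: measurable_itv].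
  have r0 := @rho_gt0 R (level n).
  have itv (x : R) : lebesgue_measure (`[x - M * rho (level n), x + M * rho (level n)]%classic
      : set R) = (2 * M * rho (level n))%:E.
    have h : 0 < M * rho (level n) by rewrite mulr_gt0.
    rewrite lebesgue_measure_itv/= lte_fin ifT; last by lra.
    by rewrite -EFinB; congr EFin; lra.
  transitivity ((2 * M * rho (level n))%:E * (2 * M * rho (level n))%:E)%E.
    by congr (_ * _)%E; exact: itv.
  by rewrite -EFinM expr2.
rewrite EFinM -muleA /area_cone_integral /area_integral.
apply: lee_wpmul2l; first by rewrite lee_fin invr_ge0 pi_ge0.
apply: (@le_trans _ _ (\sum_(0 <= n <oo) c n * leb2 (U n))%E); last first.
  rewrite /cone_sum -nneseriesZl; last first.
    by move=> n _; case: ifP => // _; exact: whitney_mass_ge0.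
  apply: lee_nneseries => [n _ _|n _]; first by rewrite mule_ge0.
  rewrite lebU /c /cond; case: ifP => _; last by rewrite mule0 mul0e.
  rewrite /whitney_mass muleAC -!EFinM muleA -EFinM.
  apply: lee_wpmul2r => //; rewrite lee_fin.
  have r0 := @rho_gt0 R (level n).
  have rN : rho (level n) != 0 :> R by rewrite gt_eqF.
  have -> : gam = (gam - 2) + 2%:R by ring.
  rewrite [X in _ <= _ * X]powRD ?rN ?implybT// powR_mulrn ?(ltW r0)// addrK exprMn.
  by rewrite le_eqVlt; apply/orP; left; apply/eqP; ring.
apply: (integral_cover_le leb2 c0 mU).
  by move=> p _; rewrite mule_ge0// lee_fin area_integrand_ge0.
move=> w [w1 hw]; rewrite cone_dist in hw.
have v0 : 0 < 1 - cabs (toC w) by rewrite subr_gt0.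
rewrite powR_area_density//.
have mD := measurable_bergman_disk tau w1.
have mDW n : measurable (bergman_disk (toC w) tau `&` whitney_piece eps n
    : set (measurableTypeR R * measurableTypeR R)).
  by apply: measurableI => //; exact: measurable_whitney_piece.
apply: (@le_trans _ _ (\sum_(0 <= n <oo) ((1 - cabs (toC w)) `^ (gam - 2))%:E *
    mu (bergman_disk (toC w) tau `&` whitney_piece eps n))%E).
  rewrite nneseriesZl//; apply: lee_wpmul2l; first by rewrite lee_fin powR_ge0.
  apply: measure_sigma_subadditive => // p Dp.
  by have [n np] := whitney_cover eps0 Dp.1; exists n.
apply: lee_nneseries => [n _ _|n _]; first by rewrite mule_ge0// lee_fin powR_ge0.
have [[z [[z1 zD] nz]]|/nonemptyPn ->] :=
    pselect (bergman_disk (toC w) tau `&` whitney_piece eps n !=set0); last first.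
  by rewrite measure0 mule0 mule_ge0// lee_fin.
have /andP[l1 l2] := whitney_piece_level nz.
have [zn nzn zE] := whitney_point_piece nz.
have r0 := @rho_gt0 R (level n).
have d1 := bergman_dist_Euclid tau0 z1 w1 zD.
have d2 : cabs (toC w - toC z) <= k * (1 - cabs (toC w)).
  rewrite cabs_distC; apply: bergman_dist_Euclid => //.
  by rewrite bergman_distC.
have d3 := whitney_square_dist (whitney_pieceW nz) (whitney_pieceW nzn).
have d1' : cabs (toC w - toC z) <= k * rho (level n).
  by apply: le_trans d1 _; rewrite ler_pM2l.
have t1 := cabs_le_dist (toC w) (toC z).
have t2 := cabs_le_dist (toC z) (toC w); rewrite (cabs_distC (toC z)) in t2.
have t3 := cabs_dist_triangle (toC z) (toC w) (toC zn).
have t4 := cabs_dist_triangle (toC w) (circ th) (toC zn).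
have wzn : cabs (toC w - toC zn) <= M * rho (level n) by rewrite /M; lra.
have vup : 1 - cabs (toC w) <= (1 + k) * rho (level n) by lra.
have /andP[l3 l4] := whitney_piece_level nzn.
have cn : cond n.
  rewrite /cond zE.
  have h1 : sigma * (1 - cabs (toC w)) <= sigma * ((1 + k) * rho (level n)).
    by rewrite ler_pM2l//; lra.
  have h2 : (sigma * (1 + k) + M) * rho (level n) <
      (sigma * (1 + k) + M) * (2 * (1 - cabs (toC zn))).
    rewrite ltr_pM2l; first by lra.
    by rewrite addr_gt0// mulr_gt0 ?addr_gt0//; lra.
  apply: le_lt_trans t4 _.
  rewrite (_ : s' = (sigma * (1 + k) + M) * 2); last by rewrite /s' /M; ring.
  by lra.
have Uw : U n w.
  have Re1 := Re_le_cabs (toC w - toC zn); have Im1 := Im_le_cabs (toC w - toC zn).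
  have := le_trans Re1 wzn; have := le_trans Im1 wzn.
  rewrite /= !ler_norml => /andP[i1 i2] /andP[j1 j2].
  by rewrite /U zE; split; rewrite /= in_itv/=; apply/andP; split; lra.
rewrite indicE mem_set// mule1 /c cn.
apply: lee_pmul => //; first by rewrite lee_fin powR_ge0.
  rewrite lee_fin; apply: powR_comparable => //.
  apply/andP; split; last by rewrite /L; nra.
  by rewrite ler_pdivrMr /L; nra.
apply: le_measure; rewrite ?inE //.
exact: measurable_whitney_piece.
Qed.

End ConeIntegrals.

(** * Polynomials are analytic *)

Section PolynomialAnalytic.
Context {R : realType}.
Implicit Types (p : {poly R[i]}).

Lemma horner_bounded p (M : R) : exists2 B : R, 0 <= B &
  forall w, cabs w <= M -> cabs p.[w] <= B.
Proof.
elim/poly_ind: p => [|p c [B B0 hB]].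
  by exists 0 => // w _; rewrite horner0 cabs0.
exists (B * `|M| + cabs c); first by rewrite addr_ge0 ?mulr_ge0 ?cabs_ge0.
move=> w wM; rewrite hornerMXaddC; apply: le_trans (cabsD _ _) _.
rewrite lerD2r cabsM ler_pM ?cabs_ge0 ?hB//.
exact: le_trans wM (ler_norm _).
Qed.

Lemma horner_factor p z : exists q, forall w, p.[w] - p.[z] = q.[w] * (w - z).
Proof.
have /factor_theorem[q pq] : root (p - p.[z]%:P) z.
  by rewrite rootE !hornerE subrr.
exists q => w.
by have := congr1 (fun r => r.[w]) pq; rewrite !hornerE.
Qed.

(** Factoring out w - z twice writes the error of the difference quotient as r(w)(w - z), with r
    bounded near z. *)
Lemma analytic_horner p : analytic_on_disk (fun z => p.[z]).
Proof.
move=> z _; have [q pq] := horner_factor p z; have [r qr] := horner_factor q z.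
have [B B0 hB] := horner_bounded r (cabs z + 1).
exists q.[z] => e e0; exists (Num.min 1 (e / (B + 1))).
  by rewrite lt_min ltr01 divr_gt0// ltr_wpDl.
move=> w /andP[wz]; rewrite lt_min => /andP[w1 we].
have wN : w - z != 0 by apply/eqP => h; move: wz; rewrite h cabs0 ltxx.
rewrite pq mulfK// qr cabsM.
have hw : cabs r.[w] <= B.
  by apply: hB; have := cabs_le_dist w z; lra.
have B1 : 0 < B + 1 by rewrite ltr_wpDl.
move: we; rewrite ltr_pdivlMr// => we.
apply: le_lt_trans we; rewrite mulrC ler_pM2l//; lra.
Qed.

End PolynomialAnalytic.

(** * Lacunary test polynomials *)

Section Lacunary.
Context {R : realType}.
Variable beta : R.
Hypothesis beta0 : 0 < beta.
Implicit Types (m k N J j : nat) (z : R[i]).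

Lemma cabs_sum (I : Type) (r : seq I) (P : pred I) (F : I -> R[i]) :
  cabs (\sum_(i <- r | P i) F i) <= \sum_(i <- r | P i) cabs (F i).
Proof.
elim/big_ind2 : _ => [|x a y b xa yb|//]; first by rewrite cabs0.
by apply: le_trans (cabsD _ _) _; exact: lerD.
Qed.

Let b : R := 2 `^ beta.
(** Chosen so that b y^2 = 1. Off-diagonal terms decay like y^(2|m-k|): one factor y^|m-k| is spent
    on smallness over a gap J, the other on summability. *)
Let y : R := 2 `^ (- (beta / 2)).

Local Lemma b_gt0 : 0 < b. Proof. exact: powR_gt0. Qed.
Local Lemma y_gt0 : 0 < y. Proof. exact: powR_gt0. Qed.
Local Lemma y_lt1 : y < 1. Proof. by apply: powR2N_lt1; rewrite divr_gt0. Qed.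

Local Lemma b_y : b * y ^+ 2 = 1.
Proof.
rewrite /b /y -powR_mulrn ?powR_ge0// -powRrM -powRD ?pnatr_eq0 ?implybT//.
by rewrite (_ : beta + _ = 0) ?powRr0//; field.
Qed.

Local Lemma b_rho m : b ^+ m = rho m `^ (- beta).
Proof.
rewrite /b /rho -powR_mulrn ?powR_ge0// -powRrM -powR_mulrn// -powRN -powRrM.
by congr (_ `^ _); ring.
Qed.

Definition nat_dist m k : nat := (m - k) + (k - m).

Lemma geometric_dist_sum (x : R) m N : 0 <= x < 1 ->
  \sum_(k < N) x ^+ nat_dist m k <= 2 / (1 - x).
Proof.
move=> x01; have /andP[x0 x1] := x01.
suff H : \sum_(k < N) x ^+ nat_dist m k <= 1 / (1 - x) + \sum_(i < m) x * x ^+ i.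
  apply: le_trans H _.
  have := geometric_sum_le m x0 x01; have : x / (1 - x) <= 1 / (1 - x).
    by rewrite ler_pM2r ?invr_gt0 ?subr_gt0// ltW.
  by lra.
elim: m N => [|m IH] N.
  rewrite big_ord0 addr0; apply: le_trans (geometric_sum_le N _ x01) => //.
  by apply: ler_sum => k _; rewrite mul1r /nat_dist sub0n subn0.
case: N => [|N].
  rewrite big_ord0 addr_ge0 ?divr_ge0 ?subr_ge0 ?(ltW x1)//.
  by apply: sumr_ge0 => i _; rewrite mulr_ge0// exprn_ge0.
rewrite big_ord_recl big_ord_recr/= [leRHS]addrA [leRHS]addrC lerD//.
- by rewrite /nat_dist subn0 sub0n addn0 exprS.
- exact: IH.
Qed.

Lemma modulus_power_le (v : R) k : 0 <= v <= 1 -> (1 - v) ^+ k <= expR (- (v * k%:R)).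
Proof.
move=> /andP[v0 v1]; rewrite -mulNr expRM_natr lerXn2r ?nnegrE ?subr_ge0 ?expR_ge0//.
exact: expR_ge1Dx.
Qed.

(** From exp(x/(k+1)) >= x/(k+1); the order k + 1 is later taken large enough to beat the growth of
    b^(2d). *)
Lemma exp_poly_decay k (x : R) : 0 < x -> expR (- x) <= (k.+1%:R / x) ^+ k.+1.
Proof.
move=> x0.
rewrite expRN -[x in leLHS](@divfK _ k.+1%:R) ?pnatr_eq0// expRM_natr -exprVn.
rewrite lerXn2r ?nnegrE ?invr_ge0 ?expR_ge0 ?divr_ge0 ?(ltW x0)//.
rewrite -[leRHS]invrK lef_pV2 ?posrE ?expR_gt0 ?invr_gt0 ?divr_gt0// invf_div.
by apply: le_trans (expR_ge1Dx _); rewrite lerDr.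
Qed.

(** For k > 0 the inverse of the right side is (1 + 1/k)^k <= e. *)
Lemma modulus_power_ge k : expR (-1) <= (1 - k.+1%:R^-1) ^+ k :> R.
Proof.
case: k => [|k]; first by rewrite expr0 expR_le1 lerN10.
rewrite expRN.
have -> : 1 - k.+2%:R^-1 = (1 + k.+1%:R^-1)^-1 :> R.
  have a0 : 0 < k.+1%:R :> R by [].
  rewrite -[k.+2]addn1 natrD; move: (k.+1%:R) a0 => a a0.
  by field; apply/andP; split; apply/eqP; lra.
rewrite exprVn lef_pV2 ?posrE ?expR_gt0 ?exprn_gt0 ?ltr_wpDr ?invr_ge0//.
have -> : expR 1 = expR (k.+1%:R^-1) ^+ k.+1 :> R.
  by rewrite -expRM_natr mulVf ?pnatr_eq0.
by rewrite lerXn2r ?nnegrE ?addr_ge0 ?invr_ge0 ?expR_ge0// expR_ge1Dx.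
Qed.

(** With exponent 2^m - 1 the bound [modulus_power_ge] applies exactly at height 2^-m, and the term
    m = 0 is a nonzero constant, so level 0 is handled even at z = 0. *)
Definition lacunary_term m z : R[i] := Complex (b ^+ m) 0 * z ^+ (2 ^ m).-1.

Lemma cabs_lacunary_term m z : cabs (lacunary_term m z) = b ^+ m * cabs z ^+ (2 ^ m).-1.
Proof. by rewrite cabsM cabsX cabs_real// exprn_ge0// ltW// b_gt0. Qed.

(** For k <= m the coefficient alone suffices: b^k = b^m y^(2(m-k)). For k = m + d > m the power of
    |z| is at most e exp(-2^d / 2), which is dominated by b^(-2d) and leaves b^m b^(-d). *)
Lemma lacunary_term_upper : exists2 C : R, 0 < C & forall m k z,
  rho m / 2 < 1 - cabs z <= rho m ->
  cabs (lacunary_term k z) <= C * b ^+ m * y ^+ (2 * nat_dist m k).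
Proof.
have [n bn] : exists n, b ^+ 2 <= 2 ^+ n.+1.
  exists (Num.truncn (b ^+ 2)); apply: ltW.
  apply: lt_le_trans (truncnS_gt _) _; exact: le_id_pow2.
pose C0 : R := expR 1 * (2 * n.+1%:R) ^+ n.+1.
have C00 : 0 < C0 by rewrite mulr_gt0 ?expR_gt0// exprn_gt0// mulr_gt0.
exists (1 + C0); first by rewrite addr_gt0.
move=> m k z /andP[l1 l2].
have bp := b_gt0; have yp := y_gt0; have r0 := @rho_gt0 R m.
have z0 := cabs_ge0 z; have z1 : cabs z <= 1 by lra.
rewrite cabs_lacunary_term.
have [km|mk] := leqP k m.
  have -> : nat_dist m k = (m - k)%N by rewrite /nat_dist (eqP km) addn0.
  have -> : b ^+ m = b ^+ k * b ^+ (m - k) by rewrite -exprD subnKC.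
  rewrite exprM !mulrA -[X in _ <= X]mulrA -exprMn b_y expr1n mulr1.
  apply: (@le_trans _ _ (b ^+ k)); first by rewrite ler_piMr ?exprn_ge0 ?exprn_ile1 ?(ltW bp).
  by rewrite ler_peMl ?exprn_ge0 ?(ltW bp)//; lra.
have -> : nat_dist m k = (k - m)%N by rewrite /nat_dist (eqP (ltnW mk)) add0n.
set d := (k - m)%N.
have kE : k = (m + d)%N by rewrite subnKC// ltnW.
have v01 : 0 <= 1 - cabs z <= 1 by apply/andP; split; lra.
have := modulus_power_le (2 ^ k).-1 v01; rewrite subKr => zk.
(* The factor e pays for the -1 in the exponent 2^k - 1. *)
have e1 : expR (- ((1 - cabs z) * (2 ^ k).-1%:R)) <= expR 1 * expR (- (2 ^+ d / 2)).
  rewrite -expRD ler_expR.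
  have -> : (2 ^ k).-1%:R = 2 ^+ k - 1 :> R.
    by rewrite -subn1 natrB ?expn_gt0// natrX.
  have : (2 : R) ^+ d / 2 <= (1 - cabs z) * 2 ^+ k.
    rewrite kE exprD mulrA mulrC ler_pM2r ?exprn_gt0//.
    have : rho m * 2 ^+ m = 1 :> R by rewrite mulVf ?expf_neq0.
    have : (rho m / 2) * 2 ^+ m <= (1 - cabs z) * 2 ^+ m by rewrite ler_wpM2r ?exprn_ge0 ?ltW.
    by lra.
  by case/andP: v01; lra.
have x0 : 0 < (2 : R) ^+ d / 2 by rewrite divr_gt0 ?exprn_gt0.
have e2 := exp_poly_decay n x0.
have e3 : (n.+1%:R / ((2 : R) ^+ d / 2)) ^+ n.+1 <= (2 * n.+1%:R) ^+ n.+1 * (b ^+ (2 * d))^-1.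
  have -> : n.+1%:R / ((2 : R) ^+ d / 2) = (2 * n.+1%:R) * (2 ^+ d)^-1.
    by field; rewrite expf_neq0.
  rewrite exprMn ler_pM2l ?exprn_gt0 ?mulr_gt0// exprVn lef_pV2 ?posrE ?exprn_gt0//.
  have -> : ((2 : R) ^+ d) ^+ n.+1 = (2 ^+ n.+1) ^+ d by rewrite -!exprM mulnC.
  by rewrite exprM lerXn2r ?nnegrE ?exprn_ge0 ?(ltW bp).
have e4 : cabs z ^+ (2 ^ k).-1 <= C0 * (b ^+ (2 * d))^-1.
  apply: le_trans zk _; apply: le_trans e1 _.
  by rewrite /C0 -mulrA ler_pM2l ?expR_gt0// (le_trans e2).
have yb : y ^+ (2 * d) = (b ^+ d)^-1.
  by apply: (mulfI (x := b ^+ d)); rewrite ?expf_neq0 ?gt_eqF// exprM -exprMn b_y expr1n divff ?expf_neq0 ?gt_eqF.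
have e5 : b ^+ k * (C0 * (b ^+ (2 * d))^-1) = C0 * b ^+ m * y ^+ (2 * d).
  by rewrite yb kE exprD mul2n -addnn exprD; field; rewrite expf_neq0 ?gt_eqF.
apply: (@le_trans _ _ (b ^+ k * (C0 * (b ^+ (2 * d))^-1))).
  by rewrite ler_pM2l// exprn_gt0.
rewrite e5 ler_wpM2r ?exprn_ge0 ?(ltW yp)// ler_wpM2r ?exprn_ge0 ?(ltW bp)//; lra.
Qed.

Lemma lacunary_term_lower m z : 1 - cabs z <= rho m ->
  expR (-1) * b ^+ m <= cabs (lacunary_term m z).
Proof.
move=> h; rewrite cabs_lacunary_term mulrC ler_pM2l ?exprn_gt0 ?b_gt0//.
have pE : (2 ^ m = (2 ^ m).-1.+1)%N by rewrite prednK// expn_gt0.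
apply: le_trans (modulus_power_ge (2 ^ m).-1) _; rewrite -pE.
have r1 : rho m <= 1 :> R by rewrite invf_le1 ?exprn_gt0// exprn_ege1// ler1n.
rewrite lerXn2r ?nnegrE ?cabs_ge0//; rewrite natrX -/(rho m); lra.
Qed.

Definition lacunary J j N z : R[i] :=
  \sum_(k < N | (k %% J == j)%N) lacunary_term k z.

Lemma analytic_lacunary J j N : analytic_on_disk (lacunary J j N).
Proof.
have -> : lacunary J j N = fun z => (\sum_(k < N | (k %% J == j)%N)
    (Complex (b ^+ k) 0)%:P * 'X^((2 ^ k).-1)).[z].
  apply/funext => z; rewrite /lacunary horner_sum; apply: eq_bigr => k _.
  by rewrite /lacunary_term !hornerE.
exact: analytic_horner.
Qed.

(* Ramey-Ullrich type test functions: with a large gap J, on the annulus of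
   level m the term of index m dominates all the others. *)
Lemma lacunary_test : exists J, (2 < J)%N /\ exists c M : R, [/\ 0 < c, 0 < M,
  (forall j N z, cabs z < 1 -> cabs (lacunary J j N z) * (1 - cabs z) `^ beta <= M) &
  (forall m j N z, (m < N)%N -> (m %% J == j)%N -> rho m / 2 < 1 - cabs z <= rho m ->
     c * rho m `^ (- beta) <= cabs (lacunary J j N z))].
Proof.
have [C C0 hC] := lacunary_term_upper.
have bp := b_gt0; have yp := y_gt0; have y1 := y_lt1.
have y01 : 0 <= y < 1 by rewrite (ltW yp).
(* With this gap factor the off-diagonal terms sum to at most half of the lower bound exp(-1) b^m
   for the main term. *)
pose e : R := expR (-1) / 2 / (C * (2 / (1 - y))).
have S0 : 0 < C * (2 / (1 - y)) by rewrite mulr_gt0// divr_gt0// subr_gt0.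
have e0 : 0 < e by rewrite divr_gt0// divr_gt0 ?expR_gt0.
have [J J2 yJ] : exists2 J, (2 < J)%N & y ^+ J <= e.
  have : y ^+ n @[n --> \oo] --> (0 : R) by apply: cvg_expr; rewrite gtr0_norm.
  move=> /cvgrPdist_le/(_ e e0)[n0 _ hn]; exists (n0 + 3)%N; first by rewrite addn3.
  have := hn (n0 + 3)%N (leq_addr _ _); rewrite /= sub0r normrN ger0_norm//.
  by rewrite exprn_ge0// ltW.
exists J; split => //.
exists (expR (-1) / 2), (C * (2 / (1 - y))); split => //.
- move=> j N z z1.
  have [|m hm] := @dyadic_level R (1 - cabs z).
    by rewrite subr_gt0 z1/= lerBlDr lerDl cabs_ge0.
  have /andP[l1 l2] := hm; have r0 := @rho_gt0 R m.
  have v0 : 0 < 1 - cabs z by rewrite subr_gt0.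
  have up : cabs (lacunary J j N z) <= C * (2 / (1 - y)) * b ^+ m.
    apply: le_trans (cabs_sum _ _ _) _.
    apply: (@le_trans _ _ (\sum_(k < N) C * b ^+ m * y ^+ nat_dist m k)).
      rewrite big_mkcond/=; apply: ler_sum => k _; case: ifP => _; last first.
        by rewrite !mulr_ge0 ?exprn_ge0 ?ltW.
      apply: le_trans (hC m k z hm) _.
      rewrite ler_pM2l ?mulr_gt0 ?exprn_gt0// ler_wiXn2l ?(ltW yp) ?(ltW y1)//.
      by rewrite leq_pmull.
    rewrite -mulr_sumr [leRHS]mulrAC ler_pM2l ?mulr_gt0 ?exprn_gt0//.
    exact: geometric_dist_sum.
  apply: (@le_trans _ _ (C * (2 / (1 - y)) * b ^+ m * rho m `^ beta)).
    apply: ler_pM; rewrite ?cabs_ge0 ?powR_ge0//.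
    by apply: ge0_ler_powR; rewrite ?nnegrE ?(ltW v0) ?(ltW r0) ?(ltW beta0).
  by rewrite b_rho -[leLHS]mulrA -powRD ?(gt_eqF r0) ?implybT// addNr powRr0 mulr1.
- move=> m j N z mN mj hm; have /andP[l1 l2] := hm.
  rewrite -b_rho /lacunary (bigD1 (Ordinal mN))//=.
  apply: le_trans (cabs_ge_dist _ _).
  have low := lacunary_term_lower l2.
  set rest := \sum_(_ < _ | _) _.
  have E1 : 0 < C * b ^+ m * e by exact: mulr_gt0 (mulr_gt0 C0 (exprn_gt0 m bp)) e0.
  have up : cabs rest <= expR (-1) / 2 * b ^+ m.
    apply: le_trans (cabs_sum _ _ _) _.
    apply: (@le_trans _ _ (\sum_(k < N) C * b ^+ m * e * y ^+ nat_dist m k)).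
      rewrite big_mkcond/=; apply: ler_sum => k _; case: ifP => [/andP[kj km]|_]; last first.
        exact: mulr_ge0 (ltW E1) (exprn_ge0 _ (ltW yp)).
      apply: le_trans (hC m k z hm) _.
      rewrite -[leRHS]mulrA ler_pM2l ?mulr_gt0 ?exprn_gt0// mul2n -addnn exprD.
      rewrite ler_pM2r ?exprn_gt0//; apply: le_trans yJ.
      rewrite ler_wiXn2l ?(ltW yp) ?(ltW y1)//.
      have mk : (m != k)%N by apply: contraNneq km => mk; apply/eqP/val_inj.
      (* Distinct indices of one class are at least J apart. *)
      have modE : m = k %[mod J] by rewrite (eqP mj) (eqP kj).
      rewrite /nat_dist; case: (ltngtP m k) mk => // lt _.
      + rewrite (eqP (ltnW lt)) add0n dvdn_leq ?subn_gt0//.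
        by rewrite -eqn_mod_dvd ?(ltnW lt)//; apply/eqP.
      + rewrite (eqP (ltnW lt)) addn0 dvdn_leq ?subn_gt0//.
        by rewrite -eqn_mod_dvd ?(ltnW lt)//; apply/eqP.
    rewrite -mulr_sumr.
    apply: (@le_trans _ _ (C * b ^+ m * e * (2 / (1 - y)))).
      by rewrite (ler_pM2l E1); exact: geometric_dist_sum.
    rewrite le_eqVlt; apply/orP; left; apply/eqP; rewrite /e; field.
    by rewrite !gt_eqF ?subr_gt0.
  by lra.
Qed.

End Lacunary.

(** * Proof of the equivalence *)

Lemma le_scale_inv (R : realType) (K : R) (x y : \bar R) : 0 < K ->
  (K%:E * x <= y)%E -> (x <= (K^-1)%:E * y)%E.
Proof.
move=> K0 h; rewrite -[x]mul1e -(_ : (K^-1)%:E * K%:E = 1)%E.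
  by rewrite -muleA lee_wpmul2l// lee_fin invr_ge0 ltW.
by rewrite -EFinM mulVf// gt_eqF.
Qed.

Lemma analytic_growth_sup (R : realType) (beta : R) (f : R[i] -> R[i]) :
  let S := ereal_sup [set (cabs (f z) * (1 - cabs z) `^ beta)%:E | z in cdisk] in
  S = +oo%E \/ exists2 M : R, S = M%:E & 0 <= M.
Proof.
move=> S.
have S0 : (0 <= S)%E.
  apply: (@le_trans _ _ (cabs (f 0) * (1 - cabs 0) `^ beta)%:E).
    by rewrite lee_fin mulr_ge0 ?cabs_ge0 ?powR_ge0.
  by apply: ereal_sup_ubound; exists 0 => //; rewrite /cdisk/= cabs0 ltr01.
case E : S S0 => [r| |] // S0; last by left.
by right; exists r.
Qed.

Unset Implicit Arguments.

Theorem theorem2 (R : realType) (beta q t sigma tau : R)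
  (mu : {measure set (measurableTypeR R * measurableTypeR R)%type -> \bar R}) :
  0 < beta -> 1 < q -> beta + 1 < t -> 1 < sigma -> 0 < tau ->
  (exists C : R, 0 < C /\
     forall f : R[i] -> R[i], analytic_on_disk f ->
       (weakLq_norm q (fun xi =>
          \int[mu]_(p in lusin_cone sigma xi)
             ((1 - cabs (toC p)) `^ t * cabs (f (toC p)) / (1 - cabs (toC p)))%:E)
        <= C%:E * ereal_sup [set (cabs (f z) * (1 - cabs z) `^ beta)%:E | z in cdisk])%E)
  <->
  (weakLq_norm q (fun xi =>
     area_integral (lusin_cone sigma xi) (fun p =>
       ((1 - cabs (toC p)) `^ (t - 1) * (1 - cabs (toC p)) `^ (- beta)
          / (1 - cabs (toC p)) ^+ 2)%:E * mu (bergman_disk (toC p) tau)))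
   < +oo)%E.
Proof.
move=> beta0 q1 _ sigma1 tau0.
have q0 : 0 < q by exact: lt_trans q1.
have [J [J2 [c [M [c0 M0 lac_up lac_low]]]]] := lacunary_test beta0.
have J0 : (0 < J)%N by rewrite (ltn_trans _ J2).
(* An aperture strictly between 1 and sigma leaves room for the loss 8 eps (s + 1) of
   [cone_of_shadow]. *)
pose s := (1 + sigma) / 2.
have s1 : 1 < s by rewrite /s; lra.
have /andP[eta0 _] := tanh_radius_bounds tau0.
have d0 : 0 < (sigma - s) / (8 * (s + 1)).
  by rewrite divr_gt0 ?mulr_gt0//; rewrite /s; lra.
have [eps [eps0 e8 e_s e_tau]] : exists eps : R,
    [/\ 0 < eps, eps <= 8^-1, s + 8 * eps * (s + 1) <= sigma & 4 * eps <= tanh_radius tau].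
  exists (Num.min 8^-1 (Num.min ((sigma - s) / (8 * (s + 1))) (tanh_radius tau / 4))).
  split.
  - by rewrite !lt_min invr_gt0 ltr0n d0 divr_gt0.
  - by rewrite ge_min lexx.
  - set e := Num.min _ _.
    have : e <= (sigma - s) / (8 * (s + 1)) by rewrite /e !ge_min lexx orbT.
    by rewrite ler_pdivlMr ?mulr_gt0//; lra.
  - set e := Num.min _ _.
    have : e <= tanh_radius tau / 4 by rewrite /e !ge_min lexx !orbT.
    by lra.
have z1 := @whitney_point_disk R eps.
pose a := whitney_mass mu beta t eps.
have a0 n : (0 <= a n)%E by exact: whitney_mass_ge0.
(* The lower comparisons give narrow sums by residue class; the upper ones need the full sum at a
   wider aperture. *)
have wide s' : 1 < s' -> (exists2 N, 0 < N & forall j, (j < J)%N ->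
    weak_tail q N (cone_sum s (whitney_point eps)
      (fun n => if (level n %% J == j)%N then a n else 0%E))) ->
    exists2 N, 0 < N & weak_tail q N (cone_sum s' (whitney_point eps) a).
  move=> s'1 [N N0 w].
  have [N1 N10 w1] := weak_tail_cone_residues q1 N0 J0 a0 w.
  by have := aperture_change z1 a0 q1 s1 s'1 N10 w1.
split.
- move=> [C [C0 H]].
  have [s' s'1 [K K0 up]] := area_cone_upper mu beta t sigma1 eps0 tau0.
  pose k0 := c / 2 `^ `|t - 1|.
  have k00 : 0 < k0 by rewrite divr_gt0 ?powR_gt0.
  have [|N N0 w] := wide s' s'1.
    exists (k0^-1 * (C * M)); first by rewrite !mulr_gt0 ?invr_gt0.
    move=> j jJ; apply: weak_tail_cone_lim => [n|k]; first by case: ifP.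
    (* The test polynomial has to contain the levels of the first k pieces; its bound C M does not
       depend on k. *)
    pose Nn := (\max_(n < k) level n).+1.
    have lim_f : weak_tail q (C * M)
        (mu_cone_integral mu t sigma (lacunary beta J j Nn)).
      apply: weak_norm_tail => //.
      + by rewrite mulr_ge0// ltW.
      + by move=> xi; exact: mu_cone_integral_ge0.
      apply: le_trans (H _ (analytic_lacunary beta J j Nn)) _.
      rewrite EFinM lee_wpmul2l ?lee_fin ?(ltW C0)//.
      by apply: ge_ereal_sup => _ [z /= z_1 <-]; rewrite lee_fin lac_up.
    apply: weak_tail_le lim_f => //.
    + by rewrite invr_ge0 ltW.
    + by rewrite mulr_ge0// ltW.
    move=> th _; apply: le_scale_inv => //.
    have := @mu_cone_lower R mu beta t sigma eps eps0 (lacunary beta J j Nn) s c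
      (fun n => (n < k)%N && (level n %% J == j)%N) th c0 e8 s1 e_s.
    rewrite (_ : (fun n => if (n < k)%N then if (level n %% J == j)%N then a n else 0%E else 0%E)
      = (fun n => if (n < k)%N && (level n %% J == j)%N then a n else 0%E)); last first.
      by apply/funext => n; case: (n < k)%N.
    apply => n p /andP[nk nj] np; apply: lac_low => //; last exact: whitney_piece_level np.
    by rewrite ltnS (leq_bigmax (Ordinal nk)).
  apply/weak_norm_lty => //; first by move=> xi; exact: area_cone_integral_ge0.
  exists (K * N); first exact: mulr_gt0.
  apply: weak_tail_le w => //; [exact: ltW|exact: ltW|].
  by move=> th _; exact: up.
- move=> /weak_norm_lty -/(_ q1) [|N N0 w].
    by move=> xi; exact: area_cone_integral_ge0.
  have [K K0 low] := area_cone_lower mu beta t eps0 e8 s1 tau0 e_s e_tau J2.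
  have s'1 : 1 < 2 * (sigma + 2 * eps) by lra.
  have [|N' N'0 w'] := wide _ s'1.
    exists (K^-1 * N); first by rewrite mulr_gt0 ?invr_gt0.
    move=> j _; apply: weak_tail_le w => //.
    + by rewrite invr_ge0 ltW.
    + exact: ltW.
    by move=> th _; apply: le_scale_inv => //; exact: low.
  exists (2 `^ `|t - 1 - beta| * N'); split; first by rewrite mulr_gt0 ?powR_gt0.
  (* An infinite supremum makes the right side +oo, the constant being positive. *)
  move=> f _; have [->|[Mf SE Mf0]] := analytic_growth_sup beta f.
    by rewrite gt0_muley ?leey// lte_fin mulr_gt0 ?powR_gt0.
  rewrite SE -EFinM.
  have fM z : cabs z < 1 -> cabs (f z) * (1 - cabs z) `^ beta <= Mf.
    by move=> zd; rewrite -lee_fin -SE; apply: ereal_sup_ubound; exists z.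
  rewrite (_ : _ * Mf = Mf * 2 `^ `|t - 1 - beta| * N'); last by ring.
  apply: weak_tail_norm => //.
  + by rewrite !mulr_ge0 ?powR_ge0// ltW.
  + by move=> xi; exact: mu_cone_integral_ge0.
  apply: weak_tail_le w' => //.
  + by rewrite mulr_ge0 ?powR_ge0.
  + exact: ltW.
  by move=> th _; exact: mu_cone_upper.
Qed.
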